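(* For each $N$ let $U$ be an $N\times N$ Haar-distributed unitary matrix, let $v\in\mathbb{C}^N$ be a unit vector independent of $U$, and let $G_N(t)=U\,(I_N-(1-t)vv^* )$. Let $\alpha>0$ be a fixed constant. Then $G_N$ does not have a strongly separated outlier towards the origin at time $t=\alpha N^{-\frac12}$ (i.e. for $t\in T_N=\{\alpha N^{-1/2}\}$).
   Context: $\mathbb{D}$ is the open unit disk and $D(z_0,r)$ the open disk of center $z_0$ and radius $r$. Eigenvalues are counted with multiplicity. A sequence of events $\Omega^{(N)}$ holds with high probability if $\mathbb{P}(\Omega^{(N)})\to1$ as $N\to\infty$. Strong separation: for $T=T_N\subset[-1,1]$ (possibly depending on $N$), $G_N$ has a strongly separated outlier towards the origin for $t\in T$ if there exist real numbers $\alpha_1<\alpha_2$ and $c_1,c_2\in(0,1)$ (independent of $N$) such that with high probability, for every $t\in T$: (i) $D\big(0,c_1\frac{N^{\alpha_1}}{1+N^{\alpha_1}}\big)$ contains exactly one eigenvalue of $G_N(t)$; (ii) $\mathbb{D}\setminus D\big(0,c_2\frac{N^{\alpha_2}}{1+N^{\alpha_2}}\big)$ contains $N-1$ eigenvalues of $G_N(t)$. *)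

(* Defs.v *)
From HB Require Import structures.
From mathcomp Require Import all_boot all_order all_algebra.
From mathcomp Require Import complex.
From mathcomp Require Import all_classical all_reals all_analysis.
Import Order.TTheory GRing.Theory Num.Theory.
Import numFieldNormedType.Exports.

Set Implicit Arguments.
Unset Strict Implicit.
Unset Printing Implicit Defensive.

Local Open Scope classical_set_scope.
Local Open Scope ring_scope.
Local Open Scope sesquilinear_scope.

(* [R[i]] itself carries no topology; at type [numClosedFieldType] it inherits
   the norm topology of a [numFieldType], and matrices the product topology. *)
Definition Cplx (R : realType) : numClosedFieldType := R[i].

Definition toC (R : realType) (x : R) : Cplx R := x%:C%C.

(* m x n complex matrices with their Borel sigma-algebra *)
Definition cmx (R : realType) (m n : nat) :=
  g_sigma_algebraType (@open 'M[Cplx R]_(m, n)).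

Definition independent_RVs d d1 d2 (T : measurableType d)
    (T1 : measurableType d1) (T2 : measurableType d2) (R : realType)
    (P : probability T R) (X : {RV P >-> T1}) (Y : {RV P >-> T2}) : Prop :=
  forall (A : set T1) (B : set T2), measurable A -> measurable B ->
    P (X @^-1` A `&` Y @^-1` B) = (P (X @^-1` A) * P (Y @^-1` B))%E.

(* The Haar measure is the unique probability measure on the compact group U(N)
   invariant under left and right translations. *)
Definition haar_unitary d (T : measurableType d) (R : realType)
    (P : probability T R) (N : nat) (U : {RV P >-> cmx R N N}) : Prop :=
  (forall w, (U w : 'M[Cplx R]_N) \is unitarymx) /\
  (forall V W : 'M[Cplx R]_N, V \is unitarymx -> W \is unitarymx ->
   forall A : set (cmx R N N), measurable A ->
     P [set w | A (V *m (U w : 'M[Cplx R]_N) *m W)] = P (U @^-1` A)).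

Definition is_unit_vector (R : realType) (N : nat) (v : 'cV[Cplx R]_N) : Prop :=
  v^t* *m v = 1%:M.

Definition rank_one_perturbation (R : realType) (N : nat)
    (U : 'M[Cplx R]_N) (v : 'cV[Cplx R]_N) (t : R) : 'M[Cplx R]_N :=
  U *m (1%:M - toC (1 - t) *: (v *m v^t*)).

(* The roots of the characteristic polynomial, with multiplicity. *)
Definition eigenvalues (R : realType) (N : nat) (A : 'M[Cplx R]_N) :
    seq (Cplx R) :=
  sval (closed_field_poly_normal (char_poly A)).

Definition num_eigenvalues_in (R : realType) (N : nat) (D : set (Cplx R))
    (A : 'M[Cplx R]_N) : nat :=
  count (fun z => z \in D) (eigenvalues A).

Definition disk (R : realType) (z0 : Cplx R) (r : R) : set (Cplx R) :=
  [set z | `|z - z0| < toC r].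

(* The sample space may depend on N. The property [E N] need not be a measurable
   set a priori; it is required to hold on measurable events whose probability
   tends to 1, which for measurable [E N] is just P(E N) --> 1. *)
Definition with_high_probability (R : realType) (d : nat -> measure_display)
    (T : forall N, measurableType (d N)) (P : forall N, probability (T N) R)
    (E : forall N, set (T N)) : Prop :=
  exists A : forall N, set (T N),
    (forall N, measurable (A N) /\ A N `<=` E N) /\
    (P N (A N) @[N --> \oo] --> (1 : \bar R)%E).

Definition separation_radius (R : realType) (c a : R) (N : nat) : R :=
  c * (N%:R `^ a / (1 + N%:R `^ a)).

(* [Ts N] is meant to be a subset of [-1, 1]. This is deliberately not a clause
   of the definition: Ts N = {a / sqrt N} satisfies it only for N large, and the
   negation of the definition must not hold because of the small N. *)
Definition strongly_separated_outlier (R : realType) (d : nat -> measure_display)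
    (T : forall N, measurableType (d N)) (P : forall N, probability (T N) R)
    (G : forall N, T N -> R -> 'M[Cplx R]_N) (Ts : nat -> set R) : Prop :=
  exists a1 a2 c1 c2 : R,
    [/\ a1 < a2, 0 < c1 < 1, 0 < c2 < 1 &
      with_high_probability P (fun N => [set w | forall t, Ts N t ->
        num_eigenvalues_in (disk 0 (separation_radius c1 a1 N)) (G N w t) = 1%N
        /\
        num_eigenvalues_in
          (disk 0 1 `\` disk 0 (separation_radius c2 a2 N)) (G N w t)
          = (N - 1)%N])].

(* Main.v *)
(* The radius of (i) never exceeds [c := c1 < 1], so it is enough that, with
   probability bounded below, [G_N(t)] has no eigenvalue in [|z| <= c]. With
   [R(z) = (1 - z U^-1)^-1], an eigenvalue [z] in the disk satisfies
   [v^* R(z) v = 1 / (1 - t)], so it suffices that [|v^* R(z) v - 1| < alpha / sqrt N]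
   on the whole disk. As the left side is typically of the same order as the right
   side, this is a small-ball estimate and not only a moment bound.

   Second moments: conjugation by permutations gives [E |R_ij|^2 = O(1/N)] off the
   diagonal. On the diagonal, replacing [U] by [W U] with [W] swapping [e_i] and [e_j]
   turns the Schur function [h_i = 1 - 1 / R_ii] into [h_i h_j] up to off-diagonal
   terms; as [|h_j| <= |z|] and [W U] is again Haar, [E |h_i|^2 = O(1/N)]. Phase
   invariance (Parseval) transfers this to the coefficients [(U^-k)_ij].

   Small value: among boundedly many entries [sqrt N R_0j], [j >= 1], two are close on
   the disk by pigeonhole, say [j] and [k]. Swapping [e_0] with [(e_j - e_k) / sqrt 2]
   moves this small difference to [R_00 - 1], up to [O(1/N)]. The number of pairs
   [(j, k)] does not depend on [N], so some pair is hit with probability bounded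
   below.

   The random [v] is frozen on the cells of a fine grid, where independence of [U]
   and [v] reduces everything to a deterministic unit vector. *)
Require Import Defs.
From HB Require Import structures.
From mathcomp Require Import all_boot all_order all_algebra.
From mathcomp Require Import perm complex ring lra.
From mathcomp Require Import all_classical all_reals all_analysis.
From mathcomp Require Import measurable_realfun.
Import Order.TTheory GRing.Theory Num.Theory.
Import numFieldNormedType.Exports.
Local Open Scope classical_set_scope.
Local Open Scope ring_scope.
Local Open Scope sesquilinear_scope.
Set Implicit Arguments.
Unset Strict Implicit.
Unset Printing Implicit Defensive.

(** * Modulus and Euclidean norm *)

(** The moment bounds hold at one point [z] at a time, whereas closeness to 1 is needed for all [z]
    of the disk at once. The coefficients [(U^-k)_ij] bridge this gap: with a radius [r] strictly
    between [c] and 1, their second moments weighted by [r^(2k)] are [O(1/n)], and the factors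
    [(c/r)^k] left over are summable, so that one event serves every [|z| <= c]. The same factors
    make all coefficients beyond some index [K] negligible. After multiplication by [sqrt n] the
    first [K] coefficients are merely bounded, not small, so Markov's inequality alone cannot bring
    [v^* R v] below the threshold. Boundedness is however what the pigeonhole needs: it compares
    [2K] bounded real numbers per column among [L] columns, where [K] and [L] depend only on [c] and
    on the required precision. The price is a probability of order [1/L^2], which still contradicts
    convergence to 1. A unitary matrix carrying [e_0] to [v] would have to be chosen measurably in
    [v]; on a cell of the grid one fixed matrix does for all values of [v], at the cost of a small
    error. *)

Definition cmod (R : realType) (z : Cplx R) : R := complex.Re `|z|.

Lemma normE (R : realType) (z : Cplx R) : `|z| = toC (cmod z).
Proof. by rewrite /cmod /toC RRe_real // normr_real. Qed.

Lemma toC_inj (R : realType) : injective (@toC R).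
Proof. by move=> x y; case. Qed.

Lemma toCD (R : realType) (x y : R) : toC (x + y) = toC x + toC y.
Proof. exact: rmorphD. Qed.
Lemma toCM (R : realType) (x y : R) : toC (x * y) = toC x * toC y.
Proof. exact: rmorphM. Qed.
Lemma toCX (R : realType) (x : R) k : toC (x ^+ k) = toC x ^+ k.
Proof. exact: rmorphXn. Qed.
Lemma toCV (R : realType) (x : R) : toC x^-1 = (toC x)^-1.
Proof. exact: fmorphV. Qed.
Lemma toC_sum (R : realType) I (r : seq I) (Q : pred I) (F : I -> R) :
  toC (\sum_(i <- r | Q i) F i) = \sum_(i <- r | Q i) toC (F i).
Proof. exact: rmorph_sum. Qed.
Lemma toC_le (R : realType) (x y : R) : (toC x <= toC y) = (x <= y).
Proof. exact: lecR. Qed.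
Lemma toC_lt (R : realType) (x y : R) : (toC x < toC y) = (x < y).
Proof. exact: ltcR. Qed.
Lemma conj_toC (R : realType) (x : R) : (toC x)^* = toC x.
Proof. by apply/CrealP; rewrite complex_real. Qed.

Lemma cmod_ge0 (R : realType) (z : Cplx R) : 0 <= cmod z.
Proof. by rewrite -toC_le -normE normr_ge0. Qed.
Lemma cmod0 (R : realType) : cmod (0 : Cplx R) = 0.
Proof. by apply: toC_inj; rewrite -normE normr0. Qed.
Lemma cmod1 (R : realType) : cmod (1 : Cplx R) = 1.
Proof. by apply: toC_inj; rewrite -normE normr1. Qed.
Lemma cmodM (R : realType) (x y : Cplx R) : cmod (x * y) = cmod x * cmod y.
Proof. by apply: toC_inj; rewrite toCM -!normE normrM. Qed.
Lemma cmodD (R : realType) (x y : Cplx R) : cmod (x + y) <= cmod x + cmod y.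
Proof. by rewrite -toC_le toCD -!normE ler_normD. Qed.
Lemma cmodN (R : realType) (x : Cplx R) : cmod (- x) = cmod x.
Proof. by apply: toC_inj; rewrite -!normE normrN. Qed.
Lemma cmodB (R : realType) (x y : Cplx R) : cmod (x - y) <= cmod x + cmod y.
Proof. by rewrite -(cmodN y) cmodD. Qed.
Lemma cmod_eq0 (R : realType) (x : Cplx R) : (cmod x == 0) = (x == 0).
Proof.
rewrite -(normr_eq0 x) normE; apply/eqP/eqP => [->//|h]; exact: toC_inj.
Qed.
Lemma cmod_conj (R : realType) (x : Cplx R) : cmod x^* = cmod x.
Proof. by apply: toC_inj; rewrite -!normE norm_conjC. Qed.
Lemma cmodV (R : realType) (x : Cplx R) : cmod x^-1 = (cmod x)^-1.
Proof.
have [->|x0] := eqVneq x 0; first by rewrite invr0 cmod0 invr0.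
apply: (mulfI (x := cmod x)); first by rewrite cmod_eq0.
by rewrite -cmodM !divff ?cmod1 ?cmod_eq0.
Qed.
Lemma cmodX (R : realType) (x : Cplx R) k : cmod (x ^+ k) = cmod x ^+ k.
Proof. by elim: k => [|k IH]; rewrite ?expr0 ?cmod1// !exprS cmodM IH. Qed.
Lemma cmod_toC (R : realType) (x : R) : cmod (toC x) = `|x|.
Proof. by rewrite /cmod normc_def /= expr0n addr0 sqrtr_sqr. Qed.
Lemma cmod_sum (R : realType) I (r : seq I) (Q : pred I) (F : I -> Cplx R) :
  cmod (\sum_(i <- r | Q i) F i) <= \sum_(i <- r | Q i) cmod (F i).
Proof.
elim/big_ind2: _ => [|x a y b hx hy|//]; first by rewrite cmod0.
by apply: le_trans (cmodD _ _) _; apply: lerD.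
Qed.
Lemma cmod_sqr (R : realType) (z : Cplx R) : toC (cmod z ^+ 2) = z * z^*.
Proof. by rewrite toCX -normE normCK. Qed.
Lemma cmod_ReIm (R : realType) (z : Cplx R) :
  cmod z ^+ 2 = complex.Re z ^+ 2 + complex.Im z ^+ 2.
Proof. by apply: toC_inj; rewrite toCX -normE -add_Re2_Im2. Qed.
Lemma cmod_le_ReIm (R : realType) (z : Cplx R) :
  cmod z <= `|complex.Re z| + `|complex.Im z|.
Proof.
rewrite -(@ler_pXn2r _ 2) ?nnegrE ?cmod_ge0 ?addr_ge0 //.
rewrite cmod_ReIm -(real_normK (num_real (complex.Re z))).
rewrite -(real_normK (num_real (complex.Im z))).
have := normr_ge0 (complex.Re z); have := normr_ge0 (complex.Im z); nra.
Qed.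
Lemma Re_le_cmod (R : realType) (z : Cplx R) : `|complex.Re z| <= cmod z.
Proof.
rewrite -(@ler_pXn2r _ 2) ?nnegrE ?cmod_ge0 //.
by rewrite cmod_ReIm real_normK ?num_real // lerDl sqr_ge0.
Qed.
Lemma Im_le_cmod (R : realType) (z : Cplx R) : `|complex.Im z| <= cmod z.
Proof.
rewrite -(@ler_pXn2r _ 2) ?nnegrE ?cmod_ge0 //.
by rewrite cmod_ReIm real_normK ?num_real // lerDr sqr_ge0.
Qed.

Definition nsq (R : realType) (n : nat) (u : 'rV[Cplx R]_n) : R :=
  \sum_j cmod (u 0 j) ^+ 2.

Lemma nsq_ge0 (R : realType) n (u : 'rV[Cplx R]_n) : 0 <= nsq u.
Proof. by apply: sumr_ge0 => j _; rewrite sqr_ge0. Qed.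

Lemma nsqE (R : realType) n (u : 'rV[Cplx R]_n) : toC (nsq u) = (u *m u^t*) 0 0.
Proof.
by rewrite toC_sum mxE; apply: eq_bigr => j _; rewrite cmod_sqr !mxE.
Qed.

Lemma nsq_entry (R : realType) n (u : 'rV[Cplx R]_n) j :
  cmod (u 0 j) ^+ 2 <= nsq u.
Proof.
rewrite /nsq (bigD1 j) //= lerDl; apply: sumr_ge0 => k _; exact: sqr_ge0.
Qed.

Lemma nsq_eq0 (R : realType) n (u : 'rV[Cplx R]_n) : nsq u = 0 -> u = 0.
Proof.
move=> u0; apply/rowP => j; rewrite mxE; apply/eqP; rewrite -cmod_eq0.
by rewrite -sqrf_eq0 eq_le sqr_ge0 andbT -u0 nsq_entry.
Qed.

Lemma nsq_delta (R : realType) n (i : 'I_n) :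
  nsq (delta_mx 0 i : 'rV[Cplx R]_n) = 1.
Proof.
rewrite /nsq (bigD1 i) //= mxE !eqxx /= cmod1 expr1n big1 ?addr0 // => j ji.
by rewrite mxE (negPf ji) andbF cmod0 expr0n.
Qed.

Lemma nsqZ (R : realType) n (a : Cplx R) (u : 'rV[Cplx R]_n) :
  nsq (a *: u) = cmod a ^+ 2 * nsq u.
Proof.
by rewrite /nsq mulr_sumr; apply: eq_bigr => j _; rewrite mxE cmodM exprMn.
Qed.

Lemma trC_mul (R : realType) m n p (A : 'M[Cplx R]_(m, n)) (B : 'M[Cplx R]_(n, p)) :
  (A *m B)^t* = B^t* *m A^t*.
Proof. by rewrite trmx_mul map_mxM. Qed.

Lemma nsq_unitary (R : realType) n (u : 'rV[Cplx R]_n) (M : 'M[Cplx R]_n) :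
  M \is unitarymx -> nsq (u *m M) = nsq u.
Proof.
move=> uM; apply: toC_inj; rewrite !nsqE trC_mul mulmxA mulmxtVK //.
Qed.

Lemma unitarymx_trC (R : realType) n (M : 'M[Cplx R]_n) :
  M \is unitarymx -> M^t* \is unitarymx.
Proof. by rewrite trmxC_unitary. Qed.

(** * Resolvents of unitary matrices *)

Fact resolv_key : unit. Proof. exact: tt. Qed.

(* Written with [\det] and [\adj] rather than [invmx] so that it is a measurable
   function of [M] even where [1 - z M^t*] is singular. *)
Definition resolv (R : realType) (n : nat) (M : 'M[Cplx R]_n) (z : Cplx R) :
  'M[Cplx R]_n :=
  locked_with resolv_key
    (let B := 1%:M - z *: M^t* in (\det B)^-1 *: \adj B).

Lemma resolvE (R : realType) n (M : 'M[Cplx R]_n) z :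
  resolv M z = (\det (1%:M - z *: M^t*))^-1 *: \adj (1%:M - z *: M^t*).
Proof. by rewrite /resolv locked_withE. Qed.

Lemma resolv_invmx (R : realType) n (M : 'M[Cplx R]_n) z :
  1%:M - z *: M^t* \in unitmx -> resolv M z = invmx (1%:M - z *: M^t*).
Proof. by move=> h; rewrite resolvE /invmx h. Qed.

(* Convexity: [|a + r b|^2 <= |a|^2 / (1 - r) + r |b|^2], summed over entries. *)
Lemma nsq_preimage_le (R : realType) n (M : 'M[Cplx R]_n) (z : Cplx R) (r : R)
    (u y : 'rV[Cplx R]_n) :
  M \is unitarymx -> r < 1 -> cmod z <= r ->
  u *m (1%:M - z *: M^t*) = y -> nsq u <= nsq y / (1 - r) ^+ 2.
Proof.
move=> uM r1 zr uy.
have r0 : 0 <= r by apply: le_trans zr; apply: cmod_ge0.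
have r1' : 0 < 1 - r by rewrite subr_gt0.
pose w := u *m M^t*.
have nw : nsq w = nsq u := nsq_unitary u (unitarymx_trC uM).
have uE : u = y + z *: w.
  by rewrite -uy mulmxBr mulmx1 -scalemxAr subrK.
suff : nsq u <= nsq y / (1 - r) + r * nsq w.
  rewrite nw ler_pdivlMr ?exprn_gt0 // expr2 mulrA -ler_pdivlMr //.
  lra.
rewrite /nsq mulr_suml mulr_sumr -big_split /=; apply: ler_sum => j _.
have cu : cmod (u 0 j) <= cmod (y 0 j) + r * cmod (w 0 j).
  rewrite {1}uE mxE [(z *: w) 0 j]mxE; apply: le_trans (cmodD _ _) _.
  by rewrite lerD2l cmodM ler_wpM2r ?cmod_ge0.
apply: (@le_trans _ _ ((cmod (y 0 j) + r * cmod (w 0 j)) ^+ 2)).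
  by rewrite ler_pXn2r ?nnegrE ?cmod_ge0 // addr_ge0 ?mulr_ge0 ?cmod_ge0.
rewrite -subr_ge0.
set a := cmod (y 0 j); set b := cmod (w 0 j).
have -> : a ^+ 2 / (1 - r) + r * b ^+ 2 - (a + r * b) ^+ 2 =
   r / (1 - r) * (a - (1 - r) * b) ^+ 2.
  by field; rewrite gt_eqF.
by rewrite mulr_ge0 ?sqr_ge0 ?divr_ge0 // ltW.
Qed.

(** A row vector in the kernel is a preimage of 0, so [nsq_preimage_le] with [r = cmod z] forces its
    norm to vanish. *)
Lemma resolv_unitmx (R : realType) n (M : 'M[Cplx R]_n) (z : Cplx R) :
  M \is unitarymx -> cmod z < 1 -> 1%:M - z *: M^t* \in unitmx.
Proof.
move=> uM z1; rewrite -row_free_unit -kermx_eq0; apply/rowV0P => u.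
move=> /sub_kermxP u0; apply: nsq_eq0; apply/eqP; rewrite eq_le nsq_ge0 andbT.
apply: le_trans (nsq_preimage_le uM z1 (lexx _) u0) _.
rewrite /nsq big1 ?mul0r // => j _; by rewrite mxE cmod0 expr0n.
Qed.

Lemma resolvK (R : realType) n (M : 'M[Cplx R]_n) (z : Cplx R) :
  M \is unitarymx -> cmod z < 1 -> resolv M z *m (1%:M - z *: M^t*) = 1%:M.
Proof. by move=> uM z1; rewrite resolv_invmx ?mulVmx ?resolv_unitmx. Qed.

Lemma resolvKV (R : realType) n (M : 'M[Cplx R]_n) (z : Cplx R) :
  M \is unitarymx -> cmod z < 1 -> (1%:M - z *: M^t*) *m resolv M z = 1%:M.
Proof. by move=> uM z1; rewrite resolv_invmx ?mulmxV ?resolv_unitmx. Qed.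

Lemma nsq_resolv (R : realType) n (M : 'M[Cplx R]_n) (z : Cplx R) (r : R)
    (y : 'rV[Cplx R]_n) : M \is unitarymx -> r < 1 -> cmod z <= r ->
  nsq (y *m resolv M z) <= nsq y / (1 - r) ^+ 2.
Proof.
move=> uM r1 zr; apply: (nsq_preimage_le uM r1 zr).
by rewrite -mulmxA resolvK ?mulmx1 //; apply: le_lt_trans r1.
Qed.

Lemma nsq_row_resolv (R : realType) n (M : 'M[Cplx R]_n) (z : Cplx R) (r : R) i :
  M \is unitarymx -> r < 1 -> cmod z <= r ->
  nsq (row i (resolv M z)) <= ((1 - r)^-1) ^+ 2.
Proof.
move=> uM r1 zr; rewrite rowE.
apply: le_trans (nsq_resolv (delta_mx 0 i) uM r1 zr) _.
by rewrite nsq_delta mul1r exprVn.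
Qed.

Lemma nsq_le_entry (R : realType) n (u : 'rV[Cplx R]_n) (b : R) j :
  0 <= b -> nsq u <= b ^+ 2 -> cmod (u 0 j) <= b.
Proof.
move=> b0 ub; rewrite -(@ler_pXn2r _ 2) ?nnegrE ?cmod_ge0 //.
exact: le_trans (nsq_entry _ _) ub.
Qed.

Lemma resolv_entry (R : realType) n (M : 'M[Cplx R]_n) (z : Cplx R) (r : R) i j :
  M \is unitarymx -> r < 1 -> cmod z <= r ->
  cmod (resolv M z i j) <= (1 - r)^-1.
Proof.
move=> uM r1 zr; have := nsq_row_resolv i uM r1 zr.
have r0 : 0 <= (1 - r)^-1 by rewrite invr_ge0 subr_ge0 ltW.
by move=> /(nsq_le_entry j r0); rewrite mxE.
Qed.

(* The Schur function [1 - 1 / (v^* R v)] is bounded by [|z|] (Schwarz lemma). *)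
Lemma resolv_diag (R : realType) n (M : 'M[Cplx R]_n) (z : Cplx R) i :
  M \is unitarymx -> cmod z < 1 ->
  cmod (resolv M z i i - 1) <= cmod z * cmod (resolv M z i i).
Proof.
move=> uM z1; pose u := row i (resolv M z).
have uE : u - delta_mx 0 i = z *: (u *m M^t*).
  have : u *m (1%:M - z *: M^t*) = delta_mx 0 i.
    by rewrite /u rowE -mulmxA resolvK // mulmx1.
  by rewrite mulmxBr mulmx1 -scalemxAr => <-; rewrite opprB addrCA subrr addr0.
(* The off-diagonal mass [s] of the row appears as [s] on the left and as [|z|^2 s] on the right;
   since [|z| < 1], it can be discarded, leaving the diagonal entry. *)
have : nsq (u - delta_mx 0 i) = cmod z ^+ 2 * nsq u.
  by rewrite uE nsqZ (nsq_unitary _ (unitarymx_trC uM)).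
rewrite /nsq (bigD1 i) //= [in RHS](bigD1 i) //= !mxE !eqxx /=.
rewrite (eq_bigr (fun j => cmod (u 0 j) ^+ 2)); last first.
  move=> j ji; congr (cmod _ ^+ 2); rewrite [LHS]mxE [X in _ + X]mxE.
  by rewrite [X in _ - X]mxE (negPf ji) andbF subr0.
set s := \sum_(j < n | _) _; rewrite mulrDr => sE.
rewrite -(@ler_pXn2r _ 2) ?nnegrE ?mulr_ge0 ?cmod_ge0 // exprMn.
have s0 : 0 <= s by apply: sumr_ge0 => j _; rewrite sqr_ge0.
have : cmod z ^+ 2 * s <= s by rewrite ler_piMl // expr_le1 ?cmod_ge0 // ltW.
move: sE; lra.
Qed.

Lemma resolv_conj (R : realType) n (M V : 'M[Cplx R]_n) (z : Cplx R) :
  M \is unitarymx -> V \is unitarymx -> cmod z < 1 ->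
  resolv (V *m M *m V^t*) z = V *m resolv M z *m V^t*.
Proof.
move=> uM uV z1.
have uV' := unitarymx_trC uV.
have VV : V *m V^t* = 1%:M by apply/unitarymxP.
have VV' : V^t* *m V = 1%:M by have /unitarymxP := uV'; rewrite trmxCK.
have u1 := mul_unitarymx (mul_unitarymx uV uM) uV'.
apply: (can_inj (mulKmx (resolv_unitmx u1 z1))).
rewrite resolvKV // !trC_mul trmxCK.
have -> : 1%:M - z *: (V *m (M^t* *m V^t*)) = V *m (1%:M - z *: M^t*) *m V^t*.
  by rewrite mulmxBr mulmx1 mulmxBl VV -!scalemxAr -scalemxAl !mulmxA.
rewrite !mulmxA -(mulmxA (V *m _) (V^t*)) VV' mulmx1 -(mulmxA V).
by rewrite resolvKV // mulmx1 VV.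
Qed.

(** The Neumann series is stopped at order [k] with an exact remainder, so no convergence of matrix
    series is ever needed. *)
Lemma resolv_neumann (R : realType) n (M : 'M[Cplx R]_n.+1) (z : Cplx R) k :
  M \is unitarymx -> cmod z < 1 ->
  resolv M z = \sum_(l < k) z ^+ l *: (M^t*) ^+ l
               + z ^+ k *: (resolv M z *m (M^t*) ^+ k).
Proof.
move=> uM z1; elim: k => [|k IH].
  by rewrite big_ord0 add0r expr0 scale1r expr0 mulmx1.
set A := M^t*; rewrite {1}IH big_ord_recr /= -addrA; congr (_ + _).
have RE : resolv M z = 1%:M + z *: (resolv M z *m A).
  have := resolvK uM z1; rewrite mulmxBr mulmx1 -scalemxAr => <-.
  by rewrite subrK.
rewrite {1}RE mulmxDl mul1mx scalerDr; congr (_ + _).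
rewrite -scalemxAl scalerA -exprSr -mulmxA.
by have -> : A *m A ^+ k = A ^+ k.+1 by rewrite exprS.
Qed.

(** * Exchanging two orthonormal vectors in the resolvent *)

Definition bil (R : realType) (n : nat) (A : 'M[Cplx R]_n) (x y : 'cV[Cplx R]_n) :
  Cplx R := (x^t* *m A *m y) 0 0.

Lemma bilE (R : realType) n (A : 'M[Cplx R]_n) (x y : 'cV[Cplx R]_n) :
  bil A x y = \sum_i \sum_j (x i 0)^* * A i j * y j 0.
Proof.
rewrite /bil mxE exchange_big; apply: eq_bigr => j _ /=.
rewrite mxE mulr_suml; apply: eq_bigr => i _; by rewrite !mxE.
Qed.

Lemma bil_delta (R : realType) n (A : 'M[Cplx R]_n) i j :
  bil A (delta_mx i 0) (delta_mx j 0) = A i j.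
Proof.
rewrite /bil -colE trmx_delta map_delta_mx.
by rewrite -rowE !mxE.
Qed.

(** For orthonormal [v] and [x] this is the Householder reflection along [x - v], a vector of
    squared norm 2; hence no normalising factor. It exchanges [v] and [x]. *)
Definition swapmx (R : realType) (n : nat) (v x : 'cV[Cplx R]_n) : 'M[Cplx R]_n :=
  1%:M - (x - v) *m (x - v)^t*.

Lemma swapmx_herm (R : realType) n (v x : 'cV[Cplx R]_n) :
  (swapmx v x)^t* = swapmx v x.
Proof.
by rewrite /swapmx raddfB /= map_mxB trmx1 map_mx1 trC_mul trmxCK.
Qed.

Definition orthonormal2 (R : realType) (n : nat) (v x : 'cV[Cplx R]_n) :=
  [/\ v^t* *m v = 1%:M, x^t* *m x = 1%:M, v^t* *m x = 0 & x^t* *m v = 0].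

Lemma swapmxL (R : realType) n (v x : 'cV[Cplx R]_n) :
  orthonormal2 v x -> swapmx v x *m v = x.
Proof.
case=> vv xx vx xv; rewrite /swapmx mulmxBl mul1mx -mulmxA.
have -> : (x - v)^t* *m v = - 1%:M.
  by rewrite raddfB /= map_mxB mulmxBl vv xv sub0r.
by rewrite mulmxN mulmx1 opprK addrC subrK.
Qed.

Lemma swapmxR (R : realType) n (v x : 'cV[Cplx R]_n) :
  orthonormal2 v x -> swapmx v x *m x = v.
Proof.
case=> vv xx vx xv; rewrite /swapmx mulmxBl mul1mx -mulmxA.
have -> : (x - v)^t* *m x = 1%:M.
  by rewrite raddfB /= map_mxB mulmxBl vx xx subr0.
by rewrite mulmx1 subKr.
Qed.

Lemma swapmxK (R : realType) n (v x : 'cV[Cplx R]_n) :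
  orthonormal2 v x -> swapmx v x *m swapmx v x = 1%:M.
Proof.
move=> vx; rewrite {2}/swapmx mulmxBr mulmx1 mulmxA mulmxBr swapmxL ?swapmxR //.
by rewrite -(opprB x v) mulNmx opprK /swapmx subrK.
Qed.

Lemma swapmx_unitary (R : realType) n (v x : 'cV[Cplx R]_n) :
  orthonormal2 v x -> swapmx v x \is unitarymx.
Proof. by move=> vx; apply/unitarymxP; rewrite swapmx_herm swapmxK. Qed.

Lemma resolv_swap (R : realType) n (M : 'M[Cplx R]_n) (z a b : Cplx R)
    (v x : 'cV[Cplx R]_n) :
  M \is unitarymx -> cmod z < 1 -> orthonormal2 v x ->
  a = bil (resolv (swapmx v x *m M) z) v v ->
  b = bil (resolv (swapmx v x *m M) z) x v ->
  let A := resolv M z in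
  a = bil A x v * (b - a + 1) + bil A x x * (a - b) /\
  a = (a - b) + bil A v v * (b - a + 1) + bil A v x * (a - b).
Proof.
move=> uM z1 vx; set W := swapmx v x; set A' := resolv (W *m M) z => aE bE A.
have uWM := mul_unitarymx (swapmx_unitary vx) uM.
pose q := W *m A' *m v; pose y := x - v.
have Wq : W *m q = A' *m v by rewrite /q !mulmxA (swapmxK vx) mul1mx.
have cE : (q - z *: (M^t* *m q)) = v + y *m (y^t* *m q).
  have : (1%:M - z *: (W *m M)^t*) *m A' *m v = v by rewrite resolvKV // mul1mx.
  rewrite -mulmxA -Wq trC_mul swapmx_herm mulmxBl mul1mx -scalemxAl.
  rewrite -mulmxA (mulmxA W W) (swapmxK vx) mul1mx.
  rewrite {1}/W /swapmx mulmxBl mul1mx -mulmxA -/y => {1}<-.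
  by rewrite addrAC subrK.
have xq : (x^t* *m q) 0 0 = a.
  rewrite aE /q !mulmxA -{1}(swapmxL vx) trC_mul swapmx_herm.
  rewrite -(mulmxA _ W W) (swapmxK vx) mulmx1; reflexivity.
have vq : (v^t* *m q) 0 0 = b.
  rewrite bE /q !mulmxA -{1}(swapmxR vx) trC_mul swapmx_herm.
  rewrite -(mulmxA _ W W) (swapmxK vx) mulmx1; reflexivity.
have kE : y^t* *m q = (a - b)%:M.
  rewrite [LHS]mx11_scalar; congr (_%:M).
  by rewrite raddfB /= map_mxB mulmxBl mxE xq [X in _ + X]mxE vq.
have qE : q = A *m v + (a - b) *: (A *m x - A *m v).
  have : A *m ((1%:M - z *: M^t*) *m q) = q by rewrite mulmxA resolvK // mul1mx.
  rewrite mulmxBl mul1mx -(scalemxAl z) cE kE mul_mx_scalar => <-.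
  by rewrite mulmxDr -scalemxAr mulmxBr.
have bq u : (u^t* *m q) 0 0 = bil A u v * (b - a + 1) + bil A u x * (a - b).
  rewrite qE mulmxDr -scalemxAr mulmxBr !mulmxA mxE [X in _ + X]mxE.
  rewrite [X in _ * X]mxE [X in _ * (_ + X)]mxE -/(bil A u v) -/(bil A u x); ring.
split; first by rewrite -bq xq.
by rewrite -addrA -(bq v) vq subrK.
Qed.

Definition schur (R : realType) (n : nat) (M : 'M[Cplx R]_n) (z : Cplx R) i :
  Cplx R := 1 - (resolv M z i i)^-1.

Lemma resolv_diag_neq0 (R : realType) n (M : 'M[Cplx R]_n) (z : Cplx R) i :
  M \is unitarymx -> cmod z < 1 -> resolv M z i i != 0.
Proof.
move=> uM z1; apply/eqP => A0; have := resolv_diag i uM z1.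
by rewrite A0 sub0r cmodN cmod1 cmod0 mulr0 ler10.
Qed.

(** The diagonal entry [A] satisfies [|A - 1| <= |A|], hence [1 <= 2 |A|]. *)
Lemma resolv_diag_ge (R : realType) n (M : 'M[Cplx R]_n) (z : Cplx R) i :
  M \is unitarymx -> cmod z < 1 -> cmod (resolv M z i i)^-1 <= 2.
Proof.
move=> uM z1; rewrite cmodV invf_ple ?posrE ?invr_gt0 //; last first.
  by rewrite lt_def cmod_eq0 resolv_diag_neq0 ?cmod_ge0.
have := resolv_diag i uM z1; set A := resolv M z i i.
have := cmodB A (A - 1); rewrite subKr cmod1.
have := cmod_ge0 A; have := cmod_ge0 z; nra.
Qed.

Lemma schur_le (R : realType) n (M : 'M[Cplx R]_n) (z : Cplx R) i :
  M \is unitarymx -> cmod z < 1 -> cmod (schur M z i) <= cmod z.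
Proof.
move=> uM z1; have A0 := resolv_diag_neq0 i uM z1.
have -> : schur M z i = (resolv M z i i - 1) / resolv M z i i.
  by rewrite /schur; field.
rewrite cmodM cmodV ler_pdivrMr ?resolv_diag //.
by rewrite lt_def cmod_eq0 A0 cmod_ge0.
Qed.

Lemma schur_resolv (R : realType) n (M : 'M[Cplx R]_n) (z : Cplx R) (r : R) i :
  M \is unitarymx -> r < 1 -> cmod z <= r ->
  cmod (resolv M z i i - 1) <= cmod (schur M z i) / (1 - r).
Proof.
move=> uM r1 zr; have z1 := le_lt_trans zr r1.
have A0 := resolv_diag_neq0 i uM z1.
have -> : resolv M z i i - 1 = schur M z i * resolv M z i i.
  by rewrite /schur; field.
by rewrite cmodM ler_wpM2l ?cmod_ge0 // resolv_entry.
Qed.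

Lemma orthonormal2_delta (R : realType) n (i j : 'I_n) : i != j ->
  @orthonormal2 R n (delta_mx i 0) (delta_mx j 0).
Proof.
move=> ij; have E (k l : 'I_n) :
    (delta_mx k 0 : 'cV[Cplx R]_n)^t* *m delta_mx l 0 = (k == l)%:R%:M.
  rewrite trmx_delta map_delta_mx mul_delta_mx_cond [RHS]mx11_scalar mxE eqxx.
  by apply/matrixP => a b; rewrite !ord1 !mxE !eqxx; case: (k == l);
    rewrite /= ?mulr1n ?mulr0n ?mxE ?eqxx.
split; rewrite E ?eqxx //; first by rewrite (negPf ij) raddf0.
by rewrite eq_sym (negPf ij) raddf0.
Qed.

(** Here [a], [b] are entries after the exchange, [A], [B] the diagonal and [p], [q] the
    off-diagonal entries before it. For [p = q = 0] the two equations give exactly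
    [1 - a^-1 = (1 - A^-1) (1 - B^-1)]; in general the error is linear in [p] and [q]. *)
Lemma schur_swap_alg (R : realType) (a b A B p q : Cplx R) (r : R) :
  0 <= r < 1 -> a != 0 -> A != 0 -> B != 0 ->
  cmod a^-1 <= 2 -> cmod A^-1 <= 2 -> cmod B^-1 <= 2 ->
  cmod a <= (1 - r)^-1 -> cmod b <= (1 - r)^-1 ->
  cmod (1 - A^-1) <= r -> cmod (1 - B^-1) <= r ->
  a = q * (b - a + 1) + B * (a - b) ->
  a = (a - b) + A * (b - a + 1) + p * (a - b) ->
  cmod (1 - a^-1) <=
    r * cmod (1 - A^-1) + 16 / (1 - r) * (cmod p + cmod q).
Proof.
move=> /andP[r0 r1] ha hA hB ha2 hA2 hB2 ha1 hb1 hs1 hs2.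
set d := b - a + 1; have -> : a - b = 1 - d by rewrite /d; ring.
move=> e1 e2; set h := 1 - A^-1 in hs1 *.
have r1' : 0 < 1 - r by rewrite subr_gt0.
have i1 : 1 <= (1 - r)^-1 by rewrite invf_ge1 // gerBl.
have hd : cmod d <= 3 * (1 - r)^-1.
  rewrite /d; apply: le_trans (cmodD _ _) _; rewrite cmod1.
  have := cmodB b a; lra.
have he : cmod (1 - d) <= 4 * (1 - r)^-1.
  apply: le_trans (cmodB _ _) _; rewrite cmod1; lra.
(* An exact identity: the last two brackets vanish when [q] and [p] do, and equal [d q] and
   [(1 - d) p] by the hypotheses. The inverses are at most 2 and [d], [1 - d] are at most 3 and 4
   times [(1 - r)^-1], whence the constant 16. *)
have hE : 1 - a^-1 = h * (1 - B^-1) + h * B^-1 * a^-1 * (a - B * (1 - d))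
                     + A^-1 * a^-1 * (a - (1 - d) - A * d).
  by rewrite /h; field; rewrite ha hA hB.
have qE : a - B * (1 - d) = d * q by rewrite {1}e1; ring.
have pE : a - (1 - d) - A * d = (1 - d) * p by rewrite {1}e2; ring.
rewrite hE qE pE; apply: le_trans (cmodD _ _) _.
have := cmodD (h * (1 - B^-1)) (h * B^-1 * a^-1 * (d * q)).
rewrite !cmodM !mulrA => h3.
have g1 : cmod h * cmod (1 - B^-1) <= r * cmod h.
  by rewrite mulrC ler_wpM2r ?cmod_ge0.
have g2 : cmod h * cmod B^-1 * cmod a^-1 * cmod d <= 16 / (1 - r).
  apply: (@le_trans _ _ (1 * 2 * 2 * (3 * (1 - r)^-1))); last lra.
  apply: ler_pM => //; rewrite ?mulr_ge0 ?cmod_ge0 //.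
  apply: ler_pM => //; rewrite ?mulr_ge0 ?cmod_ge0 //.
  apply: ler_pM => //; rewrite ?cmod_ge0 //; lra.
have g3 : cmod A^-1 * cmod a^-1 * cmod (1 - d) <= 16 / (1 - r).
  apply: (@le_trans _ _ (2 * 2 * (4 * (1 - r)^-1))); last lra.
  apply: ler_pM => //; rewrite ?mulr_ge0 ?cmod_ge0 //.
  by apply: ler_pM => //; rewrite ?cmod_ge0.
have g4 := ler_wpM2r (cmod_ge0 q) g2; have g5 := ler_wpM2r (cmod_ge0 p) g3.
lra.
Qed.

Lemma schur_swap (R : realType) n (M : 'M[Cplx R]_n) (z : Cplx R) (r : R)
    (i j : 'I_n) :
  M \is unitarymx -> r < 1 -> cmod z <= r -> i != j ->
  cmod (schur (swapmx (delta_mx i 0) (delta_mx j 0) *m M) z i) <=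
  r * cmod (schur M z i) +
  16 / (1 - r) * (cmod (resolv M z i j) + cmod (resolv M z j i)).
Proof.
move=> uM r1 zr ij; have z1 := le_lt_trans zr r1.
have r0 : 0 <= r by apply: le_trans zr; apply: cmod_ge0.
have o2 := @orthonormal2_delta R _ _ _ ij.
have uWM := mul_unitarymx (swapmx_unitary o2) uM.
have [] := resolv_swap uM z1 o2 (esym (bil_delta _ i i)) (esym (bil_delta _ j i)).
rewrite (bil_delta _ j i) (bil_delta _ j j) (bil_delta _ i i) (bil_delta _ i j).
move=> e1 e2.
have s1 := le_trans (schur_le i uM z1) zr.
have s2 := le_trans (schur_le j uM z1) zr.
exact: (schur_swap_alg (introT andP (conj r0 r1))
  (resolv_diag_neq0 i uWM z1) (resolv_diag_neq0 i uM z1) (resolv_diag_neq0 j uM z1)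
  (resolv_diag_ge i uWM z1) (resolv_diag_ge i uM z1) (resolv_diag_ge j uM z1)
  (resolv_entry i i uWM r1 zr) (resolv_entry j i uWM r1 zr) s1 s2 e1 e2).
Qed.

(** The exchange turns first-order closeness into second-order closeness:
    [a - 1 = (A - 1) d + p (1 - d)], where [d = b - a + 1] is itself [O(e)], so the first term is
    quadratic. Only [p] survives at first order, which is why it carries a second, finer bound
    [f]. *)
Lemma swap_close_alg (R : realType) (a b A B p q : Cplx R) (e f : R) :
  e <= 8^-1 -> cmod (A - 1) <= e -> cmod (B - 1) <= e ->
  cmod q <= e -> cmod p <= e -> cmod p <= f ->
  a = q * (b - a + 1) + B * (a - b) ->
  a = (a - b) + A * (b - a + 1) + p * (a - b) ->
  cmod (a - 1) <= 4 * e ^+ 2 + 2 * f.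
Proof.
move=> e8 hA hB hq hp hf.
set d := b - a + 1; have -> : a - b = 1 - d by rewrite /d; ring.
move=> e1 e2.
(* Subtracting the two equations expresses [d] by small multiples of [d] and [1 - d]; the condition
   [e <= 1/8] allows the term in [d] to be absorbed. *)
have dE : d = (B - 1 - p) * (1 - d) - (A - 1 - q) * d.
  have -> : (B - 1 - p) * (1 - d) =
    B * (1 - d) - (1 - d) - p * (1 - d) by ring.
  have -> : B * (1 - d) = a - q * d by rewrite {1}e1; ring.
  have -> : p * (1 - d) = a - (1 - d) - A * d by rewrite {1}e2; ring.
  ring.
have h1 : cmod (1 - d) <= 1 + cmod d.
  by apply: le_trans (cmodB _ _) _; rewrite cmod1.
have hd : cmod d <= 4 * e.
  have h2 : cmod d <= 2 * e * cmod (1 - d) + 2 * e * cmod d.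
    rewrite {1}dE; apply: le_trans (cmodB _ _) _; rewrite !cmodM.
    apply: lerD; apply: ler_wpM2r; rewrite ?cmod_ge0 //.
      by apply: le_trans (cmodB _ _) _; lra.
    by apply: le_trans (cmodB _ _) _; lra.
  have d0 := cmod_ge0 d; have q0 := cmod_ge0 q.
  have h3 : 2 * e * cmod (1 - d) <= 2 * e * (1 + cmod d).
    by apply: ler_wpM2l => //; lra.
  have h4 : e * cmod d <= 8^-1 * cmod d by apply: ler_wpM2r.
  lra.
have -> : a - 1 = (A - 1) * d + p * (1 - d) by rewrite {1}e2; ring.
apply: le_trans (cmodD _ _) _; rewrite !cmodM.
have g1 : cmod (A - 1) * cmod d <= e * (4 * e) by apply: ler_pM; rewrite ?cmod_ge0.
have g2 : cmod p * cmod (1 - d) <= f * 2.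
  by apply: ler_pM; rewrite ?cmod_ge0 //; lra.
lra.
Qed.

Lemma resolv_swap_close (R : realType) n (M : 'M[Cplx R]_n) (z : Cplx R)
    (v x : 'cV[Cplx R]_n) (e f : R) :
  M \is unitarymx -> cmod z < 1 -> orthonormal2 v x -> e <= 8^-1 ->
  cmod (bil (resolv M z) v v - 1) <= e -> cmod (bil (resolv M z) x x - 1) <= e ->
  cmod (bil (resolv M z) x v) <= e -> cmod (bil (resolv M z) v x) <= e ->
  cmod (bil (resolv M z) v x) <= f ->
  cmod (bil (resolv (swapmx v x *m M) z) v v - 1) <= 4 * e ^+ 2 + 2 * f.
Proof.
move=> uM z1 vx e8 hv hx hxv hvx hf.
have [e1 e2] := resolv_swap uM z1 vx erefl erefl.
exact: (swap_close_alg e8 hv hx hxv hvx hf e1 e2).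
Qed.

(** * Eigenvalues of the perturbation and stability in the vector *)

Lemma eigenvalues_resolv (R : realType) n (M : 'M[Cplx R]_n) (v : 'cV[Cplx R]_n)
    (t : R) (z : Cplx R) :
  M \is unitarymx -> t < 1 -> cmod z < 1 ->
  z \in eigenvalues (rank_one_perturbation M v t) ->
  bil (resolv M z) v v = toC (1 - t)^-1.
Proof.
move=> uM t1 z1; rewrite /eigenvalues; case: closed_field_poly_normal => s /= sE zs.
have : eigenvalue (rank_one_perturbation M v t) z.
  rewrite eigenvalue_root_char sE rootZ ?root_prod_XsubC //.
  by rewrite lead_coef_eq0 monic_neq0 // char_poly_monic.
move=> /eigenvalueP[u]; rewrite /rank_one_perturbation mulmxA.
set u' := u *m M; set b := toC (1 - t) => uE u0.
have u'E : u = u' *m M^t* by rewrite /u' mulmxtVK.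
pose k := (u' *m v) 0 0.
have kE : u' *m v = k%:M by rewrite [LHS]mx11_scalar.
have u'R : u' = (b * k) *: (v^t* *m resolv M z).
  have : u' *m (1%:M - z *: M^t*) = (b * k) *: v^t*.
    rewrite mulmxBr mulmx1 -scalemxAr -u'E -uE mulmxBr mulmx1 subKr.
    by rewrite -scalemxAr mulmxA kE mul_scalar_mx scalerA.
  move/(congr1 (mulmx^~ (resolv M z))); rewrite -mulmxA resolvKV // mulmx1.
  by rewrite -scalemxAl.
have k0 : k != 0.
  apply: contra u0 => /eqP k0; rewrite u'E u'R k0 mulr0 scale0r mul0mx //.
have : k = b * k * bil (resolv M z) v v.
  by rewrite {1}/k u'R -scalemxAl mxE.
rewrite mulrAC -[X in X = _]mul1r => /(mulIf k0) /esym bE.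
have b0 : b != 0.
  by apply/eqP => b0; move: bE; rewrite b0 mul0r => /eqP; rewrite eq_sym oner_eq0.
rewrite -[LHS](mulKf b0) bE mulr1 /b /toC.
by rewrite fmorphV.
Qed.

Lemma nsq_unit_vector (R : realType) n (v : 'cV[Cplx R]_n) :
  is_unit_vector v -> nsq v^T = 1.
Proof.
move=> v1; apply: toC_inj; rewrite nsqE (_ : toC 1 = 1 :> Cplx R) // !mxE.
have := congr1 (fun A : 'M[Cplx R]_1 => A 0 0) v1; rewrite [RHS]mxE eqxx mulr1n => <-; rewrite mxE.
by apply: eq_bigr => j _; rewrite !mxE mulrC.
Qed.

Lemma unit_vector_entry (R : realType) n (v : 'cV[Cplx R]_n) i :
  is_unit_vector v -> cmod (v i 0) <= 1.
Proof.
move=> /nsq_unit_vector v1.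
have : nsq v^T <= 1 ^+ 2 by rewrite v1 expr1n.
by move=> /(nsq_le_entry i ler01); rewrite mxE.
Qed.

(** The factor [n^2] is crude but harmless, since the mesh [d] is chosen afterwards in terms of
    [n]. *)
Lemma bil_perturb (R : realType) n (A : 'M[Cplx R]_n) (v w : 'cV[Cplx R]_n)
    (b d : R) :
  is_unit_vector v -> is_unit_vector w ->
  (forall i j, cmod (A i j) <= b) -> (forall i, cmod (v i 0 - w i 0) <= d) ->
  cmod (bil A v v - bil A w w) <= n%:R ^+ 2 * (2 * d * b).
Proof.
move=> uv uw Ab vw; rewrite !bilE -sumrB.
apply: le_trans (cmod_sum _ _ _) _.
have -> : n%:R ^+ 2 * (2 * d * b) = \sum_(i < n) \sum_(j < n) (2 * d * b).
  by rewrite !sumr_const !card_ord -mulrnA -[RHS]mulr_natl natrM expr2.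
apply: ler_sum => i _; rewrite -sumrB; apply: le_trans (cmod_sum _ _ _) _.
apply: ler_sum => j _.
have -> : (v i 0)^* * A i j * v j 0 - (w i 0)^* * A i j * w j 0 =
  A i j * ((v i 0 - w i 0)^* * v j 0 + (w i 0)^* * (v j 0 - w j 0)).
  by rewrite rmorphB; ring.
rewrite cmodM mulrC; apply: ler_pM; rewrite ?cmod_ge0 //.
apply: le_trans (cmodD _ _) _; rewrite !cmodM !cmod_conj.
have h1 : cmod (v i 0 - w i 0) * cmod (v j 0) <= d * 1.
  by apply: ler_pM; rewrite ?cmod_ge0 ?unit_vector_entry.
have h2 : cmod (w i 0) * cmod (v j 0 - w j 0) <= 1 * d.
  by apply: ler_pM; rewrite ?cmod_ge0 ?unit_vector_entry.
lra.
Qed.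

(** * Entries of the resolvent as power series in [z] *)

Definition Upow (R : realType) (n : nat) (M : 'M[Cplx R]_n.+1) (k : nat) i j :
  Cplx R := ((M^t*) ^+ k) i j.

Lemma unitarymxX (R : realType) n (M : 'M[Cplx R]_n.+1) k :
  M \is unitarymx -> M ^+ k \is unitarymx.
Proof.
move=> uM; elim: k => [|k IH].
  by apply/unitarymxP; rewrite expr0 mul1mx trmx1 map_mx1.
by rewrite exprS; apply: mul_unitarymx.
Qed.

Lemma nsq_row_Upow (R : realType) n (M : 'M[Cplx R]_n.+1) k i :
  M \is unitarymx -> nsq (row i ((M^t*) ^+ k)) = 1.
Proof.
move=> uM; rewrite rowE (nsq_unitary _ (unitarymxX k (unitarymx_trC uM))).
exact: nsq_delta.
Qed.

Lemma Upow_le1 (R : realType) n (M : 'M[Cplx R]_n.+1) k i j :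
  M \is unitarymx -> cmod (Upow M k i j) <= 1.
Proof.
move=> uM; have : nsq (row i ((M^t*) ^+ k)) <= 1 ^+ 2.
  by rewrite nsq_row_Upow // expr1n.
by move=> /(nsq_le_entry j ler01); rewrite mxE.
Qed.

Lemma resolv_entryE (R : realType) n (M : 'M[Cplx R]_n.+1) (z : Cplx R) m i j :
  M \is unitarymx -> cmod z < 1 ->
  resolv M z i j - (i == j)%:R =
  \sum_(l < m) z ^+ l.+1 * Upow M l.+1 i j
  + z ^+ m.+1 * (resolv M z *m (M^t*) ^+ m.+1) i j.
Proof.
move=> uM z1; rewrite {1}(resolv_neumann m.+1 uM z1) big_ord_recl.
rewrite expr0 scale1r expr0 -[1]/(1%:M).
set S := \sum_(_ < _) _; set T := _ *: (_ *m _).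
have -> : (1%:M + S + T) i j = (i == j)%:R + S i j + T i j.
  by rewrite [LHS]mxE [X in X + _]mxE [X in X + _ + _]mxE.
have -> : (i == j)%:R + S i j + T i j - (i == j)%:R = S i j + T i j by ring.
congr (_ + _); last by rewrite mxE.
by rewrite summxE; apply: eq_bigr => l _; rewrite mxE.
Qed.

(** Multiplication by a power of a unitary matrix keeps the norm of each row of the resolvent, so
    the remainder is bounded entrywise, independently of the dimension. *)
Lemma neumann_rem (R : realType) n (M : 'M[Cplx R]_n.+1) (z : Cplx R) (r : R) m i j :
  M \is unitarymx -> r < 1 -> cmod z <= r ->
  cmod (z ^+ m.+1 * (resolv M z *m (M^t*) ^+ m.+1) i j) <= r ^+ m.+1 / (1 - r).
Proof.
move=> uM r1 zr; rewrite cmodM cmodX.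
have r0 : 0 <= r by apply: le_trans zr; apply: cmod_ge0.
apply: ler_pM; rewrite ?exprn_ge0 ?cmod_ge0 //.
  by rewrite ler_pXn2r ?nnegrE ?cmod_ge0.
have b0 : 0 <= (1 - r)^-1 by rewrite invr_ge0 subr_ge0 ltW.
set B := (M^t*) ^+ m.+1.
have : nsq (row i (resolv M z *m B)) <= ((1 - r)^-1) ^+ 2.
  rewrite row_mul (nsq_unitary _ (unitarymxX m.+1 (unitarymx_trC uM))).
  exact: nsq_row_resolv.
by move=> /(nsq_le_entry j b0); rewrite mxE.
Qed.

Lemma resolv_entry_close (R : realType) n (M : 'M[Cplx R]_n.+1) (z : Cplx R) (r : R)
    m i j :
  M \is unitarymx -> r < 1 -> cmod z <= r ->
  cmod (resolv M z i j - (i == j)%:R) <=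
  \sum_(l < m) r ^+ l.+1 * cmod (Upow M l.+1 i j) + r ^+ m.+1 / (1 - r).
Proof.
move=> uM r1 zr; have z1 := le_lt_trans zr r1.
rewrite (resolv_entryE m) //; apply: le_trans (cmodD _ _) _.
apply: lerD; last exact: neumann_rem.
apply: le_trans (cmod_sum _ _ _) _; apply: ler_sum => l _.
rewrite cmodM cmodX ler_wpM2r ?cmod_ge0 // ler_pXn2r ?nnegrE ?cmod_ge0 //.
by apply: le_trans zr; apply: cmod_ge0.
Qed.

Lemma resolv_row_diff (R : realType) n (M : 'M[Cplx R]_n.+1) (z : Cplx R) (r : R)
    m o i j :
  M \is unitarymx -> r < 1 -> cmod z <= r -> o != i -> o != j ->
  cmod (resolv M z o i - resolv M z o j) <=
  \sum_(l < m) r ^+ l.+1 * cmod (Upow M l.+1 o i - Upow M l.+1 o j)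
  + 2 * (r ^+ m.+1 / (1 - r)).
Proof.
move=> uM r1 zr oi oj; have z1 := le_lt_trans zr r1.
have := resolv_entryE m o i uM z1; have := resolv_entryE m o j uM z1.
rewrite (negPf oi) (negPf oj) !subr0 => -> ->.
rewrite opprD addrACA -sumrB; apply: le_trans (cmodD _ _) _.
apply: lerD; last first.
  apply: le_trans (cmodB _ _) _; rewrite mulr2n mulrDl mul1r.
  by apply: lerD; apply: neumann_rem.
apply: le_trans (cmod_sum _ _ _) _; apply: ler_sum => l _.
rewrite -mulrBr cmodM cmodX ler_wpM2r ?cmod_ge0 // ler_pXn2r ?nnegrE ?cmod_ge0 //.
by apply: le_trans zr; apply: cmod_ge0.
Qed.

(** * Exchange of a basis vector with a normalised difference of two others *)

Definition diffvec (R : realType) n (i j : 'I_n) : 'cV[Cplx R]_n :=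
  toC (Num.sqrt 2^-1) *: (delta_mx i 0 - delta_mx j 0).

Lemma bil_diffvecl (R : realType) n (A : 'M[Cplx R]_n) (i j : 'I_n) (u : 'cV[Cplx R]_n) :
  bil A (diffvec R i j) u =
    toC (Num.sqrt 2^-1) * (bil A (delta_mx i 0) u - bil A (delta_mx j 0) u).
Proof.
rewrite /bil /diffvec linearZ /= map_mxZ -!scalemxAl mxE.
congr (_ * _); first exact: conj_toC.
by rewrite raddfB /= map_mxB !mulmxBl mxE [X in _ + X]mxE.
Qed.

Lemma bil_diffvecr (R : realType) n (A : 'M[Cplx R]_n) (i j : 'I_n) (u : 'cV[Cplx R]_n) :
  bil A u (diffvec R i j) =
    toC (Num.sqrt 2^-1) * (bil A u (delta_mx i 0) - bil A u (delta_mx j 0)).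
Proof.
rewrite /bil /diffvec -scalemxAr mxE; congr (_ * _).
by rewrite mulmxBr mxE [X in _ + X]mxE.
Qed.

Lemma bil1 (R : realType) n (x y : 'cV[Cplx R]_n) : x^t* *m y = (bil 1%:M x y)%:M.
Proof. by rewrite /bil mulmx1 -mx11_scalar. Qed.

Lemma sqrt_half_sqr (R : realType) :
  toC (Num.sqrt 2^-1) * toC (Num.sqrt 2^-1) = 2^-1 :> Cplx R.
Proof.
by rewrite -toCM -expr2 sqr_sqrtr ?invr_ge0 // /toC fmorphV rmorph_nat.
Qed.

Lemma bil_diffvec2 (R : realType) n (A : 'M[Cplx R]_n) (i j : 'I_n) :
  bil A (diffvec R i j) (diffvec R i j) = 2^-1 * (A i i + A j j - (A i j + A j i)).
Proof.
rewrite bil_diffvecl !bil_diffvecr !bil_delta -mulrBr mulrA sqrt_half_sqr.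
by congr (_ * _); ring.
Qed.

Lemma orthonormal2_diffvec (R : realType) n (o i j : 'I_n) :
  o != i -> o != j -> i != j -> orthonormal2 (delta_mx o 0) (diffvec R i j).
Proof.
move=> oi oj ij; split; rewrite bil1.
- by rewrite bil_delta mxE eqxx.
- rewrite bil_diffvec2 !mxE !eqxx (negPf ij) eq_sym (negPf ij) /= addr0 subr0.
  by rewrite -mulr2n -[1 *+ 2]/(2%:R) mulVf ?pnatr_eq0.
- by rewrite bil_diffvecr !bil_delta !mxE (negPf oi) (negPf oj) subrr mulr0 raddf0.
- rewrite bil_diffvecl !bil_delta !mxE !(eq_sym _ o) (negPf oi) (negPf oj).
  by rewrite subrr mulr0 raddf0.
Qed.

(** The last bound is the one that matters: [bil A v x] equals [(A o i - A o j) / sqrt 2], so two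
    nearly equal entries in row [o] make it smaller than the individual entries. The others hold for
    any three indices at which [A] is close to the identity. *)
Lemma diffvec_close (R : realType) n (A : 'M[Cplx R]_n) (o i j : 'I_n) (e f : R) :
  o != i -> o != j -> i != j ->
  (forall k l, k \in [:: o; i; j] -> l \in [:: o; i; j] ->
     cmod (A k l - (k == l)%:R) <= e) ->
  cmod (A o i - A o j) <= f ->
  let x := diffvec R i j in let v := delta_mx o 0 in
  [/\ cmod (bil A v v - 1) <= 2 * e, cmod (bil A x x - 1) <= 2 * e,
      cmod (bil A x v) <= 2 * e, cmod (bil A v x) <= 2 * e &
      cmod (bil A v x) <= f].
Proof.
move=> oi oj ij he hf x v.
have h2 : `|Num.sqrt 2^-1 : R| <= 1.
  by rewrite ger0_norm ?sqrtr_ge0 // -[leRHS]sqrtr1 ler_sqrt ?ler01 // invf_le1 ?ler1n.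
have H k l : k \in [:: o; i; j] -> l \in [:: o; i; j] -> k != l ->
    cmod (A k l) <= e.
  by move=> hk hl kl; have := he k l hk hl; rewrite (negPf kl) subr0.
have D k : k \in [:: o; i; j] -> cmod (A k k - 1) <= e.
  by move=> hk; have := he k k hk hk; rewrite eqxx.
have [mo mi mj] : [/\ o \in [:: o; i; j], i \in [:: o; i; j] & j \in [:: o; i; j]].
  by rewrite !inE !eqxx !orbT.
have S (t : Cplx R) : cmod (toC (Num.sqrt 2^-1) * t) <= cmod t.
  by rewrite cmodM cmod_toC; apply: ler_piMl => //; apply: cmod_ge0.
have ji : j != i by rewrite eq_sym.
have io : i != o by rewrite eq_sym.
have jo : j != o by rewrite eq_sym.
split; rewrite /x /v ?bil_diffvec2 ?bil_diffvecl ?bil_diffvecr ?bil_delta.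
- by have := D o mo; have := cmod_ge0 (A o o - 1); lra.
- have -> : 2^-1 * (A i i + A j j - (A i j + A j i)) - 1 =
      toC 2^-1 * ((A i i - 1) + (A j j - 1) - (A i j + A j i)).
    by rewrite /toC fmorphV rmorph_nat; field.
  rewrite cmodM cmod_toC ger0_norm ?invr_ge0 //.
  have := cmodB ((A i i - 1) + (A j j - 1)) (A i j + A j i).
  have := cmodD (A i i - 1) (A j j - 1); have := cmodD (A i j) (A j i).
  have := D i mi; have := D j mj; have := H i j mi mj ij; have := H j i mj mi ji.
  lra.
- apply: le_trans (S _) _; have := cmodB (A i o) (A j o).
  by have := H i o mi mo io; have := H j o mj mo jo; lra.
- apply: le_trans (S _) _; have := cmodB (A o i) (A o j).
  by have := H o i mo mi oi; have := H o j mo mj oj; lra.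
- exact: le_trans (S _) hf.
Qed.

Lemma resolv_swap_diffvec (R : realType) n (M : 'M[Cplx R]_n) (z : Cplx R)
    (o i j : 'I_n) (e f : R) :
  M \is unitarymx -> cmod z < 1 -> o != i -> o != j -> i != j -> e <= 16^-1 ->
  (forall k l, k \in [:: o; i; j] -> l \in [:: o; i; j] ->
     cmod (resolv M z k l - (k == l)%:R) <= e) ->
  cmod (resolv M z o i - resolv M z o j) <= f ->
  cmod (bil (resolv (swapmx (delta_mx o 0) (diffvec R i j) *m M) z)
    (delta_mx o 0) (delta_mx o 0) - 1) <= 16 * e ^+ 2 + 2 * f.
Proof.
move=> uM z1 oi oj ij e16 he hf.
have [h1 h2 h3 h4 h5] := diffvec_close oi oj ij he hf.
have e8 : 2 * e <= 8^-1 by move: e16; clear; lra.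
have -> : 16 * e ^+ 2 = 4 * (2 * e) ^+ 2 by ring.
exact: (resolv_swap_close uM z1 (orthonormal2_diffvec R oi oj ij) e8 h1 h2 h3 h4 h5).
Qed.

(** * Measurability *)

Lemma continuous_Re (R : realType) : continuous (fun z : Cplx R => complex.Re z : R).
Proof.
move=> z; apply/(@cvgrPdist_lt _ _ _ (nbhs z) (nbhs_filter z)) => e e0.
have h : \forall y \near nbhs z, `|z - y| < toC e.
  by apply/nbhs_normP; exists (toC e) => //=; rewrite toC_lt.
move: h; apply: filterS => y h.
by rewrite -toC_lt; apply: le_lt_trans h; rewrite -raddfB normE toC_le Re_le_cmod.
Qed.

Lemma continuous_Im (R : realType) : continuous (fun z : Cplx R => complex.Im z : R).
Proof.
move=> z; apply/(@cvgrPdist_lt _ _ _ (nbhs z) (nbhs_filter z)) => e e0.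
have h : \forall y \near nbhs z, `|z - y| < toC e.
  by apply/nbhs_normP; exists (toC e) => //=; rewrite toC_lt.
move: h; apply: filterS => y h.
by rewrite -toC_lt; apply: le_lt_trans h; rewrite -raddfB normE toC_le Im_le_cmod.
Qed.

Lemma cmx_continuous_measurable (R : realType) m n (f : 'M[Cplx R]_(m, n) -> R) :
  continuous f -> measurable_fun [set: cmx R m n] (f : cmx R m n -> R).
Proof.
move=> cf; apply: (measurability _ (RGenOpens.measurableE R)).
move=> _ [_ [a [b ->]] <-]; rewrite setTI; apply: sub_sigma_algebra.
by move/continuousP: cf; apply; apply: interval_open.
Qed.

(** Complex measurability is tested on real and imaginary parts, which reduces sums, products and
    inverses to real-valued functions. *)
Definition cmeas d (T : measurableType d) (R : realType) (f : T -> Cplx R) :=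
  measurable_fun [set: T] (fun x => complex.Re (f x) : R) /\
  measurable_fun [set: T] (fun x => complex.Im (f x) : R).

Lemma cmeas_entry (R : realType) m n (i : 'I_m) (j : 'I_n) :
  cmeas (fun M : cmx R m n => (M : 'M[Cplx R]_(m, n)) i j).
Proof.
split; apply: cmx_continuous_measurable => M.
  apply: (@continuous_comp _ _ _ (fun M : 'M[Cplx R]_(m, n) => M i j)
    (fun z : Cplx R => complex.Re z : R)); first exact: coord_continuous.
  exact: continuous_Re.
apply: (@continuous_comp _ _ _ (fun M : 'M[Cplx R]_(m, n) => M i j)
  (fun z : Cplx R => complex.Im z : R)); first exact: coord_continuous.
exact: continuous_Im.
Qed.

Lemma cmeas_cst d (T : measurableType d) (R : realType) (c : Cplx R) :
  cmeas (fun _ : T => c).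
Proof. by split; apply: measurable_cst. Qed.

Lemma cmeasD d (T : measurableType d) (R : realType) (f g : T -> Cplx R) :
  cmeas f -> cmeas g -> cmeas (fun x => f x + g x).
Proof.
move=> [f1 f2] [g1 g2]; split.
  under eq_fun do rewrite raddfD /=; exact: measurable_funD.
by under eq_fun do rewrite raddfD /=; exact: measurable_funD.
Qed.

Lemma cmeasN d (T : measurableType d) (R : realType) (f : T -> Cplx R) :
  cmeas f -> cmeas (fun x => - f x).
Proof.
move=> [f1 f2]; split.
  under eq_fun do rewrite raddfN /=; exact: measurable_funN.
by under eq_fun do rewrite raddfN /=; exact: measurable_funN.
Qed.

Lemma cmeasB d (T : measurableType d) (R : realType) (f g : T -> Cplx R) :
  cmeas f -> cmeas g -> cmeas (fun x => f x - g x).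
Proof. by move=> hf hg; apply: cmeasD => //; apply: cmeasN. Qed.

Lemma ReM (R : realType) (a b : Cplx R) :
  complex.Re (a * b) = complex.Re a * complex.Re b - complex.Im a * complex.Im b.
Proof. by case: a b => [? ?] [? ?]. Qed.

Lemma ImM (R : realType) (a b : Cplx R) :
  complex.Im (a * b) = complex.Re a * complex.Im b + complex.Im a * complex.Re b.
Proof. by case: a b => [? ?] [? ?]. Qed.

Lemma cmeasM d (T : measurableType d) (R : realType) (f g : T -> Cplx R) :
  cmeas f -> cmeas g -> cmeas (fun x => f x * g x).
Proof.
move=> [f1 f2] [g1 g2]; split.
  under eq_fun do rewrite ReM.
  by apply: measurable_funB;
    apply: measurable_funM.
under eq_fun do rewrite ImM.
by apply: measurable_funD;
  apply: measurable_funM.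
Qed.

Lemma cmeas_conj d (T : measurableType d) (R : realType) (f : T -> Cplx R) :
  cmeas f -> cmeas (fun x => (f x)^*).
Proof.
move=> [f1 f2]; split.
  rewrite (_ : (fun _ => _) = (fun x => complex.Re (f x))) //.
  by apply/funext => x; case: (f x).
rewrite (_ : (fun _ => _) = (fun x => - complex.Im (f x))).
  exact: measurable_funN.
by apply/funext => x; case: (f x).
Qed.

Lemma cmeas_sum d (T : measurableType d) (R : realType) I (s : seq I)
    (f : I -> T -> Cplx R) :
  (forall i, cmeas (f i)) -> cmeas (fun x => \sum_(i <- s) f i x).
Proof.
move=> hf; elim: s => [|a s IH].
  by under eq_fun do rewrite big_nil; apply: cmeas_cst.
by under eq_fun do rewrite big_cons; apply: cmeasD.
Qed.

Lemma cmeas_prod d (T : measurableType d) (R : realType) I (s : seq I)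
    (f : I -> T -> Cplx R) :
  (forall i, cmeas (f i)) -> cmeas (fun x => \prod_(i <- s) f i x).
Proof.
move=> hf; elim: s => [|a s IH].
  by under eq_fun do rewrite big_nil; apply: cmeas_cst.
by under eq_fun do rewrite big_cons; apply: cmeasM.
Qed.

Lemma measurable_cmod_sqr d (T : measurableType d) (R : realType) (f : T -> Cplx R) :
  cmeas f -> measurable_fun [set: T] (fun x => cmod (f x) ^+ 2).
Proof.
move=> [f1 f2]; under eq_fun do rewrite cmod_ReIm.
by apply: measurable_funD;
  apply: measurable_funX.
Qed.

Lemma measurable_cmod d (T : measurableType d) (R : realType) (f : T -> Cplx R) :
  cmeas f -> measurable_fun [set: T] (fun x => cmod (f x)).
Proof.
move=> hf; rewrite (_ : (fun _ => _) = (@powR R ^~ 2^-1) \o (fun x => cmod (f x) ^+ 2)).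
  apply: measurableT_comp; last exact: measurable_cmod_sqr.
  exact: measurable_powR.
apply/funext => x /=; rewrite powR12_sqrt ?sqr_ge0 // sqrtr_sqr ger0_norm //.
exact: cmod_ge0.
Qed.

Lemma cmeasV d (T : measurableType d) (R : realType) (f : T -> Cplx R) :
  cmeas f -> cmeas (fun x => (f x)^-1).
Proof.
(* The inverse is the conjugate divided by the squared modulus. With the convention that 0 has
   inverse 0, this is also correct where [f] vanishes. *)
move=> hf; have E x : (f x)^-1 = toC ((cmod (f x) ^+ 2) `^ (-1)) * (f x)^*.
  rewrite powR_inv1 ?sqr_ge0 // toCV cmod_sqr.
  have [->|f0] := eqVneq (f x) 0; first by rewrite invr0 rmorph0 mulr0.
  by rewrite invfM -mulrA mulVf ?mulr1 // conjC_eq0.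
under eq_fun do rewrite E; apply: cmeasM; last exact: cmeas_conj.
split; last exact: measurable_cst.
have h := measurableT_comp (@measurable_powR R (-1))
  (measurable_cmod_sqr hf).
exact: h.
Qed.

Definition mxmeas d (T : measurableType d) (R : realType) m n
  (F : T -> 'M[Cplx R]_(m, n)) := forall i j, cmeas (fun x => F x i j).

Lemma mxmeas_id (R : realType) m n : mxmeas (fun M : cmx R m n => M : 'M[Cplx R]_(m, n)).
Proof. by move=> i j; apply: cmeas_entry. Qed.

Lemma mxmeas_cst d (T : measurableType d) (R : realType) m n (A : 'M[Cplx R]_(m, n)) :
  mxmeas (fun _ : T => A).
Proof. by move=> i j; apply: cmeas_cst. Qed.

Lemma mxmeasM d (T : measurableType d) (R : realType) m n p
    (F : T -> 'M[Cplx R]_(m, n)) (G : T -> 'M[Cplx R]_(n, p)) :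
  mxmeas F -> mxmeas G -> mxmeas (fun x => F x *m G x).
Proof.
move=> hF hG i j; under eq_fun do rewrite mxE.
by apply: cmeas_sum => k; apply: cmeasM.
Qed.

Lemma mxmeas_trC d (T : measurableType d) (R : realType) m n
    (F : T -> 'M[Cplx R]_(m, n)) :
  mxmeas F -> mxmeas (fun x => (F x)^t*).
Proof.
by move=> hF i j; under eq_fun do rewrite !mxE; apply: cmeas_conj.
Qed.

Lemma mxmeasX d (T : measurableType d) (R : realType) n
    (F : T -> 'M[Cplx R]_n.+1) k :
  mxmeas F -> mxmeas (fun x => F x ^+ k).
Proof.
move=> hF; elim: k => [|k IH].
  by under eq_fun do rewrite expr0; apply: mxmeas_cst.
by under eq_fun do rewrite exprS; apply: mxmeasM.
Qed.

Lemma cmeas_det d (T : measurableType d) (R : realType) n (F : T -> 'M[Cplx R]_n) :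
  mxmeas F -> cmeas (fun x => \det (F x)).
Proof.
move=> hF; apply: cmeas_sum => s; apply: cmeasM; first exact: cmeas_cst.
by apply: cmeas_prod => i.
Qed.

Lemma cmeas_resolv d (T : measurableType d) (R : realType) n
    (F : T -> 'M[Cplx R]_n) z i j :
  mxmeas F -> cmeas (fun x => resolv (F x) z i j).
Proof.
move=> hF; have hB : mxmeas (fun x => 1%:M - z *: (F x)^t*).
  move=> k l; under eq_fun do rewrite mxE; apply: cmeasD; first exact: cmeas_cst.
  under eq_fun do rewrite mxE; apply: cmeasN.
  under eq_fun do rewrite mxE; apply: cmeasM; first exact: cmeas_cst.
  exact: mxmeas_trC.
under eq_fun do rewrite resolvE mxE mxE; apply: cmeasM.
  by apply: cmeasV; apply: cmeas_det.
apply: cmeasM; first exact: cmeas_cst.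
apply: cmeas_det => k l; under eq_fun do rewrite !mxE.
have := hB (lift j k) (lift i l); congr cmeas; apply/funext => x.
by rewrite !mxE.
Qed.

Lemma cmeas_schur d (T : measurableType d) (R : realType) n
    (F : T -> 'M[Cplx R]_n) z i :
  mxmeas F -> cmeas (fun x => schur (F x) z i).
Proof.
move=> hF; apply: cmeasB; first exact: cmeas_cst.
by apply: cmeasV; apply: cmeas_resolv.
Qed.

Lemma cmeas_Upow d (T : measurableType d) (R : realType) n
    (F : T -> 'M[Cplx R]_n.+1) k i j :
  mxmeas F -> cmeas (fun x => Upow (F x) k i j).
Proof. by move=> hF; apply: mxmeasX; apply: mxmeas_trC. Qed.

Lemma cmx_mul_continuous (R : realType) n (V W : 'M[Cplx R]_n) :
  continuous (fun M : 'M[Cplx R]_n => V *m M *m W).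
Proof.
have sumc I (s : seq I) (f : I -> 'M[Cplx R]_n -> Cplx R) :
    (forall i, continuous (f i)) -> continuous (fun M => \sum_(i <- s) f i M).
  move=> hf; elim: s => [|a s IH].
    under eq_fun do rewrite big_nil.
    exact: cst_continuous.
  under eq_fun do rewrite big_cons.
  by move=> M; apply: (@continuousD _ _ _ (f a)); [apply: hf|apply: IH].
have entry i j : continuous (fun M : 'M[Cplx R]_n => (V *m M *m W) i j).
  have -> : (fun M : 'M[Cplx R]_n => (V *m M *m W) i j) =
     (fun M => \sum_l \sum_k V i k * M k l * W l j).
    apply/funext => M; rewrite mxE; apply: eq_bigr => l _.
    by rewrite mxE mulr_suml.
  apply: (sumc) => l; apply: (sumc) => k M.
  have h1 : {for M, continuous (fun M : 'M[Cplx R]_n => V i k * M k l)}.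
    by apply: continuousM; [exact: cst_continuous|exact: coord_continuous].
  have h2 : {for M, continuous (fun _ : 'M[Cplx R]_n => W l j)}.
    exact: cst_continuous.
  exact: (continuousM h1 h2).
move=> M0 A /= [Q HQ QA].
have : \forall M \near M0, forall i j, Q i j ((V *m M *m W) i j).
  apply: (filter_forall (nbhs_filter M0)) => i.
  apply: (filter_forall (nbhs_filter M0)) => j.
  exact: (entry i j M0 _ (HQ i j)).
by apply: filterS => M HM; apply: QA.
Qed.

Lemma cmx_mul_measurable (R : realType) n (V W : 'M[Cplx R]_n) :
  measurable_fun [set: cmx R n n]
    ((fun M : 'M[Cplx R]_n => V *m M *m W) : cmx R n n -> cmx R n n).
Proof.
apply: (@measurability _ _ (cmx R n n) (cmx R n n) setT _
  (@open 'M[Cplx R]_n) erefl) => _ [A oA <-]; rewrite setTI.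
apply: sub_sigma_algebra.
by have /continuousP := @cmx_mul_continuous R n V W; apply.
Qed.

(** * Expectation under Haar measure *)

Definition Ex d (T : measurableType d) (R : realType) (P : probability T R)
    n (U : {RV P >-> cmx R n n}) (phi : 'M[Cplx R]_n -> R) : R :=
  \int[P]_w phi (U w).

(** Measurability is asked on all matrices, but boundedness only on the unitary ones: these are the
    values of a Haar unitary, and the resolvent estimates hold there. *)
Definition tame (R : realType) n (phi : 'M[Cplx R]_n -> R) :=
  measurable_fun [set: cmx R n n] (phi : cmx R n n -> R) /\
  exists B : R, forall M, M \is unitarymx -> `|phi M| <= B.

Lemma tame_cst (R : realType) n (c : R) : tame (fun _ : 'M[Cplx R]_n => c).
Proof. by split; [exact: measurable_cst|exists `|c|]. Qed.

Lemma tameD (R : realType) n (f g : 'M[Cplx R]_n -> R) :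
  tame f -> tame g -> tame (fun M => f M + g M).
Proof.
move=> [mf [B hB]] [mg [C hC]]; split; first exact: measurable_funD.
exists (B + C) => M uM; apply: le_trans (ler_normD _ _) _.
by apply: lerD; [apply: hB|apply: hC].
Qed.

Lemma tameM (R : realType) n (f g : 'M[Cplx R]_n -> R) :
  tame f -> tame g -> tame (fun M => f M * g M).
Proof.
move=> [mf [B hB]] [mg [C hC]]; split; first exact: measurable_funM.
exists (B * C) => M uM; rewrite normrM.
by apply: ler_pM; rewrite ?normr_ge0 //; [apply: hB|apply: hC].
Qed.

Lemma tameZ (R : realType) n (c : R) (f : 'M[Cplx R]_n -> R) :
  tame f -> tame (fun M => c * f M).
Proof. by move=> hf; apply: tameM => //; apply: tame_cst. Qed.

Lemma tame_sum (R : realType) n I (s : seq I) (f : I -> 'M[Cplx R]_n -> R) :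
  (forall i, tame (f i)) -> tame (fun M => \sum_(i <- s) f i M).
Proof.
move=> hf; elim: s => [|a s IH].
  by under eq_fun do rewrite big_nil; apply: tame_cst.
by under eq_fun do rewrite big_cons; apply: tameD.
Qed.

Lemma tame_cmod_sqr (R : realType) n (f : 'M[Cplx R]_n -> Cplx R) (B : R) :
  cmeas (f : cmx R n n -> Cplx R) ->
  (forall M, M \is unitarymx -> cmod (f M) <= B) ->
  tame (fun M => cmod (f M) ^+ 2).
Proof.
move=> mf hB; split; first exact: measurable_cmod_sqr.
exists (B ^+ 2) => M uM; rewrite ger0_norm ?sqr_ge0 //.
rewrite ler_pXn2r ?nnegrE ?cmod_ge0 ?hB //.
exact: le_trans (cmod_ge0 _) (hB _ uM).
Qed.

Lemma tame_mul (R : realType) n (V W : 'M[Cplx R]_n) (f : 'M[Cplx R]_n -> R) :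
  V \is unitarymx -> W \is unitarymx -> tame f ->
  tame (fun M => f (V *m M *m W)).
Proof.
move=> uV uW [mf [B hB]]; split.
  exact: (measurableT_comp mf (@cmx_mul_measurable R n V W)).
by exists B => M uM; apply: hB; rewrite !mul_unitarymx.
Qed.

Section ExTheory.
Context d (T : measurableType d) (R : realType) (P : probability T R)
    n (U : {RV P >-> cmx R n n}) (hU : haar_unitary U).

Lemma measurable_phiU (phi : 'M[Cplx R]_n -> R) :
  measurable_fun [set: cmx R n n] (phi : cmx R n n -> R) ->
  measurable_fun [set: T] (fun w => phi (U w)).
Proof. by move=> mphi; apply: measurableT_comp. Qed.

Lemma tame_integrable (phi : 'M[Cplx R]_n -> R) : tame phi ->
  P.-integrable [set: T] (EFin \o (fun w => phi (U w))).
Proof.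
move=> [mphi [B hB]]; apply: measurable_bounded_integrable => //.
- by rewrite (le_lt_trans (probability_le1 P _)) ?ltry.
- exact: measurable_phiU.
exists B; split; first exact: num_real.
by move=> x Bx w _ /=; apply: le_trans (hB _ (hU.1 w)) (ltW Bx).
Qed.

Lemma ExD (f g : 'M[Cplx R]_n -> R) : tame f -> tame g ->
  Ex U (fun M => f M + g M) = Ex U f + Ex U g.
Proof. by move=> hf hg; rewrite /Ex RintegralD //; apply: tame_integrable. Qed.

Lemma ExZ c (f : 'M[Cplx R]_n -> R) : tame f ->
  Ex U (fun M => c * f M) = c * Ex U f.
Proof. by move=> hf; rewrite /Ex RintegralZl //; apply: tame_integrable. Qed.

Lemma Ex_cst c : Ex U (fun _ => c) = c.
Proof. by rewrite /Ex Rintegral_cst // [X in fine X](probability_setT P) mulr1. Qed.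

Lemma Ex_sum I (s : seq I) (f : I -> 'M[Cplx R]_n -> R) :
  (forall i, tame (f i)) ->
  Ex U (fun M => \sum_(i <- s) f i M) = \sum_(i <- s) Ex U (f i).
Proof.
move=> hf; elim: s => [|a s IH].
  by under eq_fun do rewrite big_nil; rewrite Ex_cst big_nil.
under eq_fun do rewrite big_cons.
by rewrite ExD ?IH ?big_cons //; apply: tame_sum.
Qed.

Lemma Ex_le (f g : 'M[Cplx R]_n -> R) : tame f -> tame g ->
  (forall M, M \is unitarymx -> f M <= g M) -> Ex U f <= Ex U g.
Proof.
move=> hf hg fg; apply: le_Rintegral => //; try exact: tame_integrable.
by move=> w _; apply: fg; apply: hU.1.
Qed.

Lemma Ex_ge0 (f : 'M[Cplx R]_n -> R) : tame f ->
  (forall M, M \is unitarymx -> 0 <= f M) -> 0 <= Ex U f.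
Proof.
by move=> hf f0; rewrite -(Ex_cst 0); apply: Ex_le => //; apply: tame_cst.
Qed.

Lemma Ex_eq (f g : 'M[Cplx R]_n -> R) :
  (forall M, M \is unitarymx -> f M = g M) -> Ex U f = Ex U g.
Proof. by move=> fg; apply: eq_Rintegral => w _; apply: fg; apply: hU.1. Qed.

(** The Haar property concerns events; it says that [phi (V U W)] and [phi (U)] have the same
    distribution on the real line, and expectations are integrals against that distribution. *)
Lemma Ex_invariant (phi : 'M[Cplx R]_n -> R) (V W : 'M[Cplx R]_n) :
  V \is unitarymx -> W \is unitarymx -> tame phi ->
  Ex U (fun M => phi (V *m M *m W)) = Ex U phi.
Proof.
move=> uV uW hphi; have hphi' := tame_mul uV uW hphi; have [mphi [B hB]] := hphi.
(* Adding the bound [B] makes the integrand nonnegative on unitary matrices, and the maximum with 0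
   makes it so everywhere, as integration against a pushforward of a nonnegative function
   requires. *)
suff H : Ex U (fun M => Num.max 0 (phi (V *m M *m W) + B)) =
         Ex U (fun M => Num.max 0 (phi M + B)).
  have B0 M : M \is unitarymx -> 0 <= phi M + B.
    by move=> /hB; rewrite ler_norml => /andP[h _]; rewrite -lerBlDr sub0r.
  apply: (addIr B); rewrite -[in LHS](Ex_cst B) -[in RHS](Ex_cst B).
  rewrite -!ExD //; try exact: tame_cst.
  transitivity (Ex U (fun M => Num.max 0 (phi (V *m M *m W) + B))).
    by apply: Ex_eq => M uM; apply/esym/max_idPr/B0; rewrite !mul_unitarymx.
  by rewrite H; apply: Ex_eq => M uM; apply/max_idPr/B0.
pose X w := phi (V *m U w *m W); pose Y w := phi (U w).
have mX : measurable_fun [set: T] X by apply: measurable_phiU hphi'.1.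
have mY : measurable_fun [set: T] Y by apply: measurable_phiU.
pose g (y : R) : \bar R := (Num.max 0 (y + B))%:E.
have mg : measurable_fun [set: R] g.
  apply/measurable_EFinP.
  apply: measurable_maxr; first exact: measurable_cst.
  by apply: measurable_funD => //; exact: measurable_cst.
have g0 : {in [set: R], forall y, (0 <= g y)%E}.
  by move=> y _; rewrite lee_fin le_max lexx.
rewrite /Ex /Rintegral; congr fine.
have -> : (\int[P]_w (Num.max 0 (phi (V *m U w *m W) + B))%:E =
          \int[pushforward P X]_y g y)%E.
  by rewrite (ge0_integral_pushforward mX) // preimage_setT.
have -> : (\int[P]_w (Num.max 0 (phi (U w) + B))%:E =
          \int[pushforward P Y]_y g y)%E.
  by rewrite (ge0_integral_pushforward mY) // preimage_setT.
apply: eq_measure_integral => A mA _ /=.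
have mA' : measurable ((phi : cmx R n n -> R) @^-1` A).
  by rewrite -[X in measurable X]setTI; apply: mphi.
exact: (hU.2 V W uV uW _ mA').
Qed.

Lemma Ex_markov (f : 'M[Cplx R]_n -> R) c : tame f ->
  (forall M, M \is unitarymx -> 0 <= f M) -> 0 < c ->
  (P [set w | (c <= f (U w))%R] <= (Ex U f / c)%:E)%E.
Proof.
move=> hf f0 c0; have mf : measurable_fun [set: T] (fun w => (f (U w))%:E).
  by apply/measurable_EFinP; apply: measurable_phiU hf.1.
have := @le_integral_abse _ _ _ P _ (measurableT) _ c mf c0.
rewrite setTI; under eq_integral => w _ do rewrite abse_EFin ger0_norm ?f0 ?hU.1//.
have -> : [set x | (c%:E <= `|(f (U x))%:E|)%E] = [set w | c <= f (U w)].
  by apply/seteqP; split => w /=; rewrite lee_fin ger0_norm ?f0 ?hU.1.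
have : (\int[P]_w (f (U w))%:E)%E \is a fin_num.
  by apply: integrable_fin_num => //; apply: tame_integrable.
move=> /fineK; rewrite -/(Rintegral _ _ _) -/(Ex U f) => <-.
have mA : measurable [set w | c <= f (U w)].
  rewrite (_ : [set w | _] = (fun w => f (U w)) @^-1` `[c, +oo[%classic).
    by rewrite -[X in measurable X]setTI; apply: (measurable_phiU hf.1).
  by apply/seteqP; split => w /=; rewrite in_itv /= andbT.
rewrite -(fineK (fin_num_measure P _ mA)).
by move=> h; rewrite lee_fin ler_pdivlMr // mulrC -lee_fin EFinM fineK ?fin_num_measure.
Qed.

End ExTheory.

(** * Second moments *)

Lemma perm_mx_unitary (R : realType) n (s : {perm 'I_n}) :
  (perm_mx s : 'M[Cplx R]_n) \is unitarymx.
Proof.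
by apply/unitarymxP; rewrite tr_perm_mx map_perm_mx -perm_mxM mulgV perm_mx1.
Qed.

Lemma perm_mx_conj_entry (R : realType) n (s : {perm 'I_n}) (A : 'M[Cplx R]_n) i j :
  (perm_mx s *m A *m (perm_mx s)^t*) i j = A (s i) (s j).
Proof.
rewrite tr_perm_mx map_perm_mx -row_permE.
by rewrite -[s in perm_mx s^-1]invgK -col_permE !mxE invgK.
Qed.

(** Conjugation by the transposition of [j] and [l] fixes [i], so all [n] off-diagonal entries of
    row [i] have the same second moment, and together they weigh at most the squared norm of the
    row. The equivariant map [F] is kept abstract to cover both the resolvent and the powers. *)
Lemma offdiag_moment d (T : measurableType d) (R : realType) (P : probability T R)
    n (U : {RV P >-> cmx R n.+1 n.+1}) (F : 'M[Cplx R]_n.+1 -> 'M[Cplx R]_n.+1)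
    (B : R) i j :
  haar_unitary U -> mxmeas (F : cmx R n.+1 n.+1 -> 'M[Cplx R]_n.+1) ->
  0 <= B ->
  (forall M i, M \is unitarymx -> nsq (row i (F M)) <= B ^+ 2) ->
  (forall M V, M \is unitarymx -> V \is unitarymx ->
     F (V *m M *m V^t*) = V *m F M *m V^t*) ->
  i != j -> n%:R * Ex U (fun M => cmod (F M i j) ^+ 2) <= B ^+ 2.
Proof.
move=> hU mF B0 FB FV ij.
have hE M k l : M \is unitarymx -> cmod (F M k l) <= B.
  by move=> uM; have := nsq_le_entry l B0 (FB M k uM); rewrite mxE.
have tE k l : tame (fun M => cmod (F M k l) ^+ 2).
  by apply: (@tame_cmod_sqr _ _ _ B) => [|M uM]; [apply: mF|apply: hE].
have exch l : l != i ->
    Ex U (fun M => cmod (F M i l) ^+ 2) = Ex U (fun M => cmod (F M i j) ^+ 2).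
  move=> li; pose V : 'M[Cplx R]_n.+1 := perm_mx (tperm j l).
  have uV : V \is unitarymx by apply: perm_mx_unitary.
  have uV' : V^t* \is unitarymx by rewrite trmxC_unitary.
  have eF M : M \is unitarymx ->
      cmod (F M i l) ^+ 2 = cmod (F (V *m M *m V^t*) i j) ^+ 2.
    have ji : j != i by rewrite eq_sym.
    by move=> uM; rewrite FV // perm_mx_conj_entry tpermL tpermD.
  rewrite (Ex_eq hU eF); apply: (Ex_invariant hU uV uV' (tE i j)).
rewrite -[X in _ <= X](Ex_cst U).
have -> : n%:R * Ex U (fun M => cmod (F M i j) ^+ 2) =
    \sum_(l < n.+1 | l != i) Ex U (fun M => cmod (F M i l) ^+ 2).
  rewrite (eq_bigr _ exch) sumr_const cardC1 card_ord -[RHS]mulr_natl //.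
rewrite big_mkcond /=.
have -> : \sum_l (if l != i then Ex U (fun M => cmod (F M i l) ^+ 2) else 0) =
    Ex U (fun M => \sum_l (if l != i then cmod (F M i l) ^+ 2 else 0)).
  rewrite Ex_sum // => [|l]; last by case: (l != i); [exact: tE|exact: tame_cst].
  by apply: eq_bigr => l _; case: (l != i) => //; rewrite Ex_cst.
apply: Ex_le => //.
- by apply: tame_sum => l; case: (l != i); [exact: tE|exact: tame_cst].
- exact: tame_cst.
move=> M uM; apply: le_trans (FB M i uM); apply: ler_sum => l _.
by rewrite mxE; case: ifP => // _; apply: sqr_ge0.
Qed.

Lemma Upow_conj (R : realType) n (M V : 'M[Cplx R]_n.+1) k :
  V \is unitarymx ->
  ((V *m M *m V^t*)^t*) ^+ k = V *m (M^t*) ^+ k *m V^t*.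
Proof.
move=> uV; have /unitarymxP VV := uV.
have VV' : V^t* *m V = 1%:M.
  by have := uV; rewrite -trmxC_unitary => /unitarymxP; rewrite trmxCK.
rewrite !trC_mul trmxCK mulmxA; elim: k => [|k IH].
  by rewrite !expr0 mulmx1 VV.
rewrite !exprS IH -[V *m _ *m _ * _]/(_ *m _) !mulmxA.
by rewrite -(mulmxA (V *m _) (V^t*)) VV' mulmx1 -(mulmxA V (M^t*)).
Qed.

Lemma offdiag_Upow d (T : measurableType d) (R : realType) (P : probability T R)
    n (U : {RV P >-> cmx R n.+1 n.+1}) k i j :
  haar_unitary U -> i != j ->
  n%:R * Ex U (fun M => cmod (Upow M k i j) ^+ 2) <= 1.
Proof.
move=> hU ij; rewrite -[leRHS](expr1n R 2).
apply: (offdiag_moment (F := fun M => (M^t*) ^+ k) hU) => //.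
- by apply: mxmeasX; apply: mxmeas_trC; apply: mxmeas_id.
- by move=> M l uM; rewrite nsq_row_Upow // expr1n.
- by move=> M V uM uV; apply: Upow_conj.
Qed.

Lemma offdiag_resolv d (T : measurableType d) (R : realType) (P : probability T R)
    n (U : {RV P >-> cmx R n.+1 n.+1}) (z : Cplx R) (r : R) i j :
  haar_unitary U -> r < 1 -> cmod z <= r -> i != j ->
  n%:R * Ex U (fun M => cmod (resolv M z i j) ^+ 2) <= ((1 - r)^-1) ^+ 2.
Proof.
move=> hU r1 zr ij.
apply: (offdiag_moment (F := fun M => resolv M z) hU) => //.
- by move=> k l; apply: cmeas_resolv; apply: mxmeas_id.
- by rewrite invr_ge0 subr_ge0 ltW.
- by move=> M l uM; apply: nsq_row_resolv.
- by move=> M V uM uV; apply: resolv_conj => //; apply: le_lt_trans r1.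
Qed.

Lemma tame_resolv (R : realType) n (z : Cplx R) i j :
  cmod z < 1 -> tame (fun M : 'M[Cplx R]_n => cmod (resolv M z i j) ^+ 2).
Proof.
move=> z1; apply: tame_cmod_sqr => [|M uM]; last exact: (resolv_entry i j uM z1).
by apply: cmeas_resolv; apply: mxmeas_id.
Qed.

Lemma tame_schur (R : realType) n (z : Cplx R) i :
  cmod z < 1 -> tame (fun M : 'M[Cplx R]_n => cmod (schur M z i) ^+ 2).
Proof.
move=> z1; apply: tame_cmod_sqr => [|M uM]; last exact: schur_le.
by apply: cmeas_schur; apply: mxmeas_id.
Qed.

(** The right side of the hypothesis is a convex combination, with weights [r] and [1 - r], of [h]
    and [K (p + q) / (1 - r)]. The square therefore keeps the contraction factor [r], and
    [(p + q)^2 <= 2 (p^2 + q^2)] accounts for the 2. *)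
Lemma schur_convex (R : realType) (r K h' h p q : R) :
  0 <= r -> r < 1 -> 0 <= K -> 0 <= h' -> 0 <= h -> 0 <= p -> 0 <= q ->
  h' <= r * h + K * (p + q) ->
  h' ^+ 2 <= r * h ^+ 2 + 2 * K ^+ 2 / (1 - r) * (p ^+ 2 + q ^+ 2).
Proof.
move=> r0 r1 K0 h'0 h0 p0 q0 hle; have r1' : 0 < 1 - r by rewrite subr_gt0.
apply: (@le_trans _ _ ((r * h + K * (p + q)) ^+ 2)).
  by rewrite ler_pXn2r ?nnegrE ?addr_ge0 ?mulr_ge0 ?addr_ge0.
rewrite -subr_ge0.
have -> : r * h ^+ 2 + 2 * K ^+ 2 / (1 - r) * (p ^+ 2 + q ^+ 2)
   - (r * h + K * (p + q)) ^+ 2 =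
   r / (1 - r) * ((1 - r) * h - K * (p + q)) ^+ 2
   + K ^+ 2 / (1 - r) * (p - q) ^+ 2.
  by field; rewrite gt_eqF.
by rewrite addr_ge0 // mulr_ge0 ?sqr_ge0 // divr_ge0 ?sqr_ge0 // ltW.
Qed.

(* Swapping [e_i] and [e_j] multiplies the two Schur functions up to off-diagonal
   terms, and [|schur| <= r < 1]; since the swap preserves Haar measure, the second
   moment satisfies [x <= r x + O(1/n)]. *)
Lemma schur_moment d (T : measurableType d) (R : realType) (P : probability T R)
    n (U : {RV P >-> cmx R n.+1 n.+1}) (z : Cplx R) (r : R) i j :
  haar_unitary U -> r < 1 -> cmod z <= r -> i != j ->
  n%:R * Ex U (fun M => cmod (schur M z i) ^+ 2) <=
  4 * (16 / (1 - r)) ^+ 2 / (1 - r) ^+ 4.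
Proof.
move=> hU r1 zr ij; have z1 := le_lt_trans zr r1.
have r0 : 0 <= r by apply: le_trans zr; apply: cmod_ge0.
have r1' : 0 < 1 - r by rewrite subr_gt0.
pose W : 'M[Cplx R]_n.+1 := swapmx (delta_mx i 0) (delta_mx j 0).
have uW : W \is unitarymx by apply: swapmx_unitary; apply: orthonormal2_delta.
have u1 : (1%:M : 'M[Cplx R]_n.+1) \is unitarymx.
  by apply/unitarymxP; rewrite mul1mx trmx1 map_mx1.
set K := 16 / (1 - r); set x := Ex U _.
have ts := @tame_schur R n.+1 z i z1.
have ji : j != i by rewrite eq_sym.
have tp := @tame_resolv R n.+1 z i j z1.
have tq := @tame_resolv R n.+1 z j i z1.
have xE : x = Ex U (fun M => cmod (schur (W *m M *m 1%:M) z i) ^+ 2).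
  by rewrite (Ex_invariant hU uW u1 ts).
have xle : x <= r * x + 2 * K ^+ 2 / (1 - r) *
    (Ex U (fun M => cmod (resolv M z i j) ^+ 2)
     + Ex U (fun M => cmod (resolv M z j i) ^+ 2)).
  have t2 := tameZ (2 * K ^+ 2 / (1 - r)) (tameD tp tq).
  rewrite -(ExD hU tp tq) -(ExZ hU _ (tameD tp tq)) -(ExZ hU r ts).
  rewrite -(ExD hU (tameZ r ts) t2) xE.
  apply: (Ex_le hU (tame_mul uW u1 ts) (tameD (tameZ r ts) t2)).
  move=> M uM; rewrite mulmx1; have := schur_swap uM r1 zr ij.
  exact: (schur_convex r0 r1 (divr_ge0 (ler0n _ _) (ltW r1')) (cmod_ge0 _)
    (cmod_ge0 _) (cmod_ge0 _) (cmod_ge0 _)).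
have := offdiag_resolv hU r1 zr ij; have := offdiag_resolv hU r1 zr ji.
move: xle; clear xE; clearbody x; set p := Ex U (fun M => cmod (resolv M z i j) ^+ 2).
set q := Ex U (fun M => cmod (resolv M z j i) ^+ 2); move: p q => p q xle hq hp.
have H : n%:R * x * (1 - r) <= 2 * K ^+ 2 / (1 - r) * (n%:R * p + n%:R * q).
  have : n%:R * (x - r * x) <= n%:R * (2 * K ^+ 2 / (1 - r) * (p + q)).
    by rewrite ler_wpM2l // lerBlDl.
  have -> : n%:R * (x - r * x) = n%:R * x * (1 - r) by ring.
  have -> : n%:R * (2 * K ^+ 2 / (1 - r) * (p + q)) =
    2 * K ^+ 2 / (1 - r) * (n%:R * p + n%:R * q) by ring.
  by [].
have H2 : 2 * K ^+ 2 / (1 - r) * (n%:R * p + n%:R * q) <=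
    2 * K ^+ 2 / (1 - r) * (2 * ((1 - r)^-1) ^+ 2).
  apply: ler_wpM2l; first exact: divr_ge0 (mulr_ge0 (ler0n _ 2) (sqr_ge0 _)) (ltW r1').
  by rewrite -[2 * _]/((1 + 1) * _) mulrDl mul1r; apply: lerD.
have := le_trans H H2; rewrite -ler_pdivlMr // => /le_trans; apply.
rewrite le_eqVlt; apply/orP; left; apply/eqP; field; exact: lt0r_neq0.
Qed.

(** The bound of [schur_moment] divided by [(1 - r)^2], the loss in passing from the Schur function
    to the resolvent. The added 1 makes the constant also dominate the off-diagonal bound. *)
Definition Cvar (R : realType) (r : R) : R := 1 + 4 * (16 / (1 - r)) ^+ 2 / (1 - r) ^+ 6.

Lemma Cvar_ge1 (R : realType) (r : R) : r < 1 -> 1 <= Cvar r.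
Proof.
move=> r1; rewrite lerDl; apply: divr_ge0; last by rewrite exprn_ge0 // subr_ge0 ltW.
exact: mulr_ge0 (ler0n _ 4) (sqr_ge0 _).
Qed.

Lemma tame_resolv1 (R : realType) n (z : Cplx R) i :
  cmod z < 1 -> tame (fun M : 'M[Cplx R]_n => cmod (resolv M z i i - 1) ^+ 2).
Proof.
move=> z1; apply: (@tame_cmod_sqr _ _ _ ((1 - cmod z)^-1 + 1)) => [|M uM].
  apply: cmeasB; last exact: cmeas_cst.
  by apply: cmeas_resolv; apply: mxmeas_id.
by apply: le_trans (cmodB _ _) _; rewrite cmod1 lerD2r resolv_entry.
Qed.

Lemma diag_resolv_moment d (T : measurableType d) (R : realType) (P : probability T R)
    n (U : {RV P >-> cmx R n.+1 n.+1}) (z : Cplx R) (r : R) i j :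
  haar_unitary U -> r < 1 -> cmod z <= r -> i != j ->
  n%:R * Ex U (fun M => cmod (resolv M z i i - 1) ^+ 2) <= Cvar r.
Proof.
move=> hU r1 zr ij; have z1 := le_lt_trans zr r1.
have r1' : 0 < 1 - r by rewrite subr_gt0.
have ts := @tame_schur R n.+1 z i z1.
have le1 : Ex U (fun M => cmod (resolv M z i i - 1) ^+ 2) <=
    ((1 - r)^-1) ^+ 2 * Ex U (fun M => cmod (schur M z i) ^+ 2).
  rewrite -(ExZ hU _ ts); apply: (Ex_le hU (@tame_resolv1 R n.+1 z i z1) (tameZ _ ts)).
  move=> M uM; rewrite -exprMn mulrC; have h := schur_resolv i uM r1 zr.
  have h0 := le_trans (cmod_ge0 _) h.
  by apply: (lerXn2r 2) => //; rewrite nnegrE ?cmod_ge0.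
have := schur_moment hU r1 zr ij.
set x := Ex U (fun M => cmod (schur M z i) ^+ 2) in le1 *; move=> xle.
apply: (@le_trans _ _ (((1 - r)^-1) ^+ 2 * (n%:R * x))).
  by apply: le_trans (ler_wpM2l (ler0n _ n) le1) _; rewrite mulrCA.
apply: (@le_trans _ _ (((1 - r)^-1) ^+ 2 * (4 * (16 / (1 - r)) ^+ 2 / (1 - r) ^+ 4))).
  by rewrite ler_wpM2l ?sqr_ge0.
rewrite /Cvar -subr_ge0.
have -> : 1 + 4 * (16 / (1 - r)) ^+ 2 / (1 - r) ^+ 6 -
   ((1 - r)^-1) ^+ 2 * (4 * (16 / (1 - r)) ^+ 2 / (1 - r) ^+ 4) = 1.
  by field; exact: lt0r_neq0.
exact: ler01.
Qed.

Lemma tame_Upow (R : realType) n k i j :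
  tame (fun M : 'M[Cplx R]_n.+1 => cmod (Upow M k i j) ^+ 2).
Proof.
apply: tame_cmod_sqr => [|M uM]; last exact: (Upow_le1 k i j uM).
by apply: cmeas_Upow; apply: mxmeas_id.
Qed.

(** * Phase invariance and second moments of the coefficients *)

Lemma unit_root_opp1 (R : realType) p : (0 < p)%N ->
  exists2 w : Cplx R, w ^+ p = -1 & cmod w = 1.
Proof.
move=> p0; exists (p.-root (-1)); first by rewrite rootCK.
apply/eqP; rewrite -(@pexpr_eq1 _ _ p) ?cmod_ge0 //.
by rewrite -cmodX rootCK // cmodN cmod1.
Qed.

Lemma scalar_unitary (R : realType) n (w : Cplx R) :
  cmod w = 1 -> (w%:M : 'M[Cplx R]_n) \is unitarymx.
Proof.
move=> w1; apply/unitarymxP; rewrite tr_scalar_mx map_scalar_mx -scalar_mxM.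
by congr (_%:M); rewrite -cmod_sqr w1 expr1n.
Qed.

Lemma Upow_scale (R : realType) n (M : 'M[Cplx R]_n.+1) (w : Cplx R) k i j :
  Upow (w%:M *m M *m 1%:M) k i j = w^* ^+ k * Upow M k i j.
Proof.
rewrite /Upow mulmx1 mul_scalar_mx linearZ /= map_mxZ exprZn mxE //.
Qed.

Definition reprod (R : realType) (a b : Cplx R) : R := complex.Re (a * b^*).

Lemma tame_reprod (R : realType) n (f g : 'M[Cplx R]_n -> Cplx R) (B : R) :
  cmeas (f : cmx R n n -> Cplx R) -> cmeas (g : cmx R n n -> Cplx R) ->
  (forall M, M \is unitarymx -> cmod (f M) <= B) ->
  (forall M, M \is unitarymx -> cmod (g M) <= B) ->
  tame (fun M => reprod (f M) (g M)).
Proof.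
move=> mf mg hf hg; split; first exact: (cmeasM mf (cmeas_conj mg)).1.
exists (B * B) => M uM; apply: le_trans (Re_le_cmod _) _.
by rewrite cmodM cmod_conj; apply: ler_pM; rewrite ?cmod_ge0 ?hf ?hg.
Qed.

(** Multiplying [U] by a scalar [w] of modulus 1 multiplies the product of the [k]-th coefficient
    with the conjugate of the [l]-th by [w^(l - k)]. Choosing this power to be -1 shows that the
    expectation equals its own negative, without averaging over the circle. *)
Lemma cross_moment d (T : measurableType d) (R : realType) (P : probability T R)
    n (U : {RV P >-> cmx R n.+1 n.+1}) (c e : R) k l i j :
  haar_unitary U -> (k < l)%N ->
  Ex U (fun M => reprod (toC c * Upow M k i j) (toC e * Upow M l i j)) = 0.
Proof.
move=> hU kl; have [|w wE w1] := @unit_root_opp1 R (l - k); first by rewrite subn_gt0.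
set phi := fun M => _.
have tp : tame phi.
  apply: (@tame_reprod _ _ _ _ (`|c| + `|e|)).
  - by apply: cmeasM; [exact: cmeas_cst|apply: cmeas_Upow; apply: mxmeas_id].
  - by apply: cmeasM; [exact: cmeas_cst|apply: cmeas_Upow; apply: mxmeas_id].
  - move=> M uM; rewrite cmodM cmod_toC; have := Upow_le1 k i j uM.
    have := cmod_ge0 (Upow M k i j); have := normr_ge0 c; have := normr_ge0 e; nra.
  - move=> M uM; rewrite cmodM cmod_toC; have := Upow_le1 l i j uM.
    have := cmod_ge0 (Upow M l i j); have := normr_ge0 c; have := normr_ge0 e; nra.
have u1 : (1%:M : 'M[Cplx R]_n.+1) \is unitarymx.
  by apply/unitarymxP; rewrite mul1mx trmx1 map_mx1.
have H : Ex U phi = -1 * Ex U phi.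
  rewrite -(ExZ hU _ tp) -{1}(Ex_invariant hU (scalar_unitary _ w1) u1 tp).
  apply: Ex_eq => // M uM; rewrite /phi !Upow_scale /reprod mulN1r -raddfN /=.
  congr complex.Re; rewrite -(subnK (ltnW kl)) exprD !rmorphM /= !rmorphXn /= conjCK.
  have wk : w^* ^+ k * w ^+ k = 1.
    by rewrite -exprMn mulrC -cmod_sqr w1 expr1n expr1n.
  rewrite wE subnK ?(ltnW kl) //.
  have -> : forall a b cc dd : Cplx R, 
    a * (w^* ^+ k * b) * (cc * (-1 * w ^+ k * dd)) = - (w^* ^+ k * w ^+ k) * (a * b * (cc * dd)).
    by move=> *; ring.
  by rewrite wk mulN1r.
lra.
Qed.

Lemma cmod_sqrD (R : realType) (a b : Cplx R) :
  cmod (a + b) ^+ 2 = cmod a ^+ 2 + cmod b ^+ 2 + 2 * reprod a b.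
Proof.
by rewrite !cmod_ReIm /reprod; case: a b => [a1 a2] [b1 b2] /=; ring.
Qed.

Lemma reprod_suml (R : realType) I (s : seq I) (f : I -> Cplx R) b :
  reprod (\sum_(i <- s) f i) b = \sum_(i <- s) reprod (f i) b.
Proof. by rewrite /reprod mulr_suml raddf_sum. Qed.

Lemma expr_small (R : realType) (r eps : R) : 0 <= r < 1 -> 0 < eps ->
  exists m0, forall m, (m0 <= m)%N -> r ^+ m <= eps.
Proof.
move=> /andP[r0 r1] e0.
have cv : (GRing.exp r : R^nat) @ \oo --> (0 : R).
  by apply: cvg_expr; rewrite ger0_norm.
move/cvgrPdist_le : cv => /(_ _ e0) [m0 _ hm].
exists m0 => m mm; have := hm m mm.
by rewrite /= sub0r normrN ger0_norm ?exprn_ge0.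
Qed.

(** With [r = s^2], Bernoulli's inequality bounds [m s^m], and the other factor [s^m] tends to 0. *)
Lemma natr_expr_small (R : realType) (r eps : R) : 0 <= r < 1 -> 0 < eps ->
  exists m0, forall m, (m0 <= m)%N -> m%:R * r ^+ m <= eps.
Proof.
move=> /andP[r0 r1] e0.
have [->|rn0] := eqVneq r 0.
  exists 1%N => -[//|m] _; by rewrite expr0n mulr0 ltW.
have rp : 0 < r by rewrite lt_def rn0.
pose s := Num.sqrt r.
have sp : 0 < s by rewrite sqrtr_gt0.
have s1 : s < 1 by rewrite -sqrtr1 ltr_sqrt ?ltr01.
have ss : r = s ^+ 2 by rewrite sqr_sqrtr.
pose h := s^-1 - 1.
have h0 : 0 < h by rewrite subr_gt0 invf_gt1.
have bern m : m%:R * h <= (1 + h) ^+ m.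
  elim: m => [|m IH]; first by rewrite mul0r expr0 ler01.
  have g1 : 1 <= (1 + h) ^+ m by rewrite exprn_ege1 // lerDl ltW.
  rewrite exprS -natr1; nra.
have msm m : m%:R * s ^+ m <= h^-1.
  rewrite -[h^-1]mul1r ler_pdivlMr // mulrAC.
  have -> : s = (1 + h)^-1 by rewrite /h addrC subrK invrK.
  by rewrite exprVn ler_pdivrMr ?(exprn_gt0 _ (addr_gt0 ltr01 h0)) // mul1r.
have s01 : 0 <= s < 1 by rewrite ltW.
have [m0 hm] := expr_small s01 (mulr_gt0 e0 h0).
exists m0 => m mm; rewrite ss -exprM mulnC exprM expr2 mulrA.
apply: (@le_trans _ _ (h^-1 * (eps * h))).
  by apply: ler_pM; rewrite ?mulr_ge0 ?exprn_ge0 ?(ltW sp) ?hm.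
by rewrite mulrCA mulVf ?mulr1 // gt_eqF.
Qed.

Lemma parseval d (T : measurableType d) (R : realType) (P : probability T R)
    n (U : {RV P >-> cmx R n.+1 n.+1}) (c : nat -> R) m i j :
  haar_unitary U ->
  Ex U (fun M => cmod (\sum_(l < m) toC (c l) * Upow M l.+1 i j) ^+ 2) =
  \sum_(l < m) c l ^+ 2 * Ex U (fun M => cmod (Upow M l.+1 i j) ^+ 2).
Proof.
move=> hU.
have mU e k : cmeas (fun M : cmx R n.+1 n.+1 => toC e * Upow M k i j).
  by apply: cmeasM; [exact: cmeas_cst|apply: cmeas_Upow; apply: mxmeas_id].
have bU e k (M : 'M[Cplx R]_n.+1) : M \is unitarymx -> cmod (toC e * Upow M k i j) <= `|e|.
  by move=> uM; rewrite cmodM cmod_toC ler_piMr // Upow_le1.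
have mS p : cmeas (fun M : cmx R n.+1 n.+1 => \sum_(l < p) toC (c l) * Upow M l.+1 i j).
  by apply: cmeas_sum => l; apply: mU.
have bS p (M : 'M[Cplx R]_n.+1) : M \is unitarymx ->
    cmod (\sum_(l < p) toC (c l) * Upow M l.+1 i j) <= \sum_(l < p) `|c l|.
  move=> uM; apply: le_trans (cmod_sum _ _ _) _; apply: ler_sum => l _.
  exact: bU.
have tS p := tame_cmod_sqr (mS p) (bS p).
elim: m => [|m IH].
  rewrite big_ord0 -[RHS](Ex_cst U); apply: Ex_eq => // M _.
  by rewrite big_ord0 cmod0 expr0n.
pose cr l M := reprod (toC (c l) * Upow M l.+1 i j) (toC (c m) * Upow M m.+1 i j).
have tc l : tame (cr l).
  apply: (@tame_reprod _ _ _ _ (`|c l| + `|c m|)) => // M uM.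
    by apply: le_trans (bU _ _ _ uM) _; rewrite lerDl.
  by apply: le_trans (bU _ _ _ uM) _; rewrite lerDr.
have tsc : tame (fun M => \sum_(l < m) cr l M) by apply: tame_sum => l; apply: tc.
rewrite big_ord_recr /= -IH -(ExZ hU _ (tame_Upow _ _ _ _)).
have tU := tameZ (c m ^+ 2) (tame_Upow R m.+1 i j).
rewrite -[RHS]addr0.
have -> : 0 = 2 * Ex U (fun M => \sum_(l < m) cr l M).
  rewrite (Ex_sum hU _ (fun l : 'I_m => tc l)) big1 ?mulr0 // => l _.
  by apply: cross_moment => //; rewrite ltnS.
rewrite -(ExZ hU _ tsc) -(ExD hU (tS m) tU) -(ExD hU (tameD (tS m) tU) (tameZ 2 tsc)).
apply: Ex_eq => // M uM; rewrite big_ord_recr /= cmod_sqrD reprod_suml.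
by rewrite [cmod (_ * Upow _ _ _ _)]cmodM cmod_toC exprMn real_normK ?num_real.
Qed.

(** Off the diagonal the coefficients are bounded directly. On the diagonal, Parseval at the real
    point [z = r] bounds the sum of all weighted moments by the second moment of [R_ii - 1], and one
    term is at most the sum. *)
Lemma Upow_moment d (T : measurableType d) (R : realType) (P : probability T R)
    n (U : {RV P >-> cmx R n.+1 n.+1}) (r : R) l i j :
  haar_unitary U -> (0 < n)%N -> 0 < r < 1 ->
  n%:R * ((r ^+ l.+1) ^+ 2 * Ex U (fun M => cmod (Upow M l.+1 i j) ^+ 2)) <=
  3 * Cvar r.
Proof.
move=> hU n0 /andP[r0 r1].
have C1 := Cvar_ge1 r1.
have [<-|ij] := eqVneq i j; last first.
  apply: (@le_trans _ _ (1 * 1)); last by lra.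
  rewrite mulrCA; apply: ler_pM.
  - by rewrite sqr_ge0.
  - by rewrite mulr_ge0 //; apply: Ex_ge0 => // [|M _]; [exact: tame_Upow|exact: sqr_ge0].
  - by rewrite -exprM exprn_ile1 // ltW.
  - exact: offdiag_Upow.
have [k ki] : exists k : 'I_n.+1, i != k.
  have [i0|i0] := eqVneq i ord0; last by exists ord0.
  by exists (Ordinal (n0 : (1 < n.+1)%N)); rewrite i0.
pose z : Cplx R := toC r.
have zr : cmod z <= r by rewrite cmod_toC ger0_norm // ltW.
have z1 := le_lt_trans zr r1.
have r1' : 0 < 1 - r by rewrite subr_gt0.
have np : 0 < n%:R :> R by rewrite ltr0n.
(* With this precision the truncation error contributes [1/(2n) <= 1] after multiplication by [n].
   The order [m] may depend on [n], because the bound on a single term does not involve it. *)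
pose eps := (1 - r) / (2 * n%:R).
have eps0 : 0 < eps by rewrite divr_gt0 // mulr_gt0.
have r01 : 0 <= r < 1 by rewrite ltW.
have [m0 hm0] := expr_small r01 eps0.
pose m := (maxn m0 l.+1); have lm : (l < m)%N by rewrite leq_maxr.
have rm : r ^+ m.+1 <= eps by apply: hm0; rewrite leqW // leq_maxl.
have tR := @tame_resolv1 R n.+1 z i z1.
pose S M := \sum_(q < m) toC (r ^+ q.+1) * Upow M q.+1 i i.
have SE M : M \is unitarymx -> cmod (S M) ^+ 2 <=
    2 * cmod (resolv M z i i - 1) ^+ 2 + 2 * (eps / (1 - r)) ^+ 2.
  move=> uM; have := resolv_entryE m i i uM z1; rewrite eqxx.
  set rem := z ^+ m.+1 * _ => E.
  have remle : cmod rem <= eps / (1 - r).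
    apply: le_trans (neumann_rem m i i uM r1 zr) _.
    by rewrite ler_wpM2r // invr_ge0 ltW.
  have sE : S M = (resolv M z i i - 1) - rem.
    rewrite E addrK /S; apply: eq_bigr => q _; by rewrite toCX.
  have := cmodB (resolv M z i i - 1) rem; rewrite -sE.
  move: (cmod_ge0 (S M)) (cmod_ge0 (resolv M z i i - 1)) (cmod_ge0 rem) remle.
  move: (cmod (S M)) (cmod (resolv M z i i - 1)) (cmod rem) (eps / (1 - r)).
  move=> a b c e a0 b0 c0 ce abc.
  have h1 : a ^+ 2 <= (b + e) ^+ 2.
    by apply: (lerXn2r 2); rewrite ?nnegrE //; lra.
  have : 0 <= (b - e) ^+ 2 by apply: sqr_ge0.
  lra.
have E2 : \sum_(q < m) (r ^+ q.+1) ^+ 2 * Ex U (fun M => cmod (Upow M q.+1 i i) ^+ 2)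
   <= 2 * Ex U (fun M => cmod (resolv M z i i - 1) ^+ 2) + 2 * (eps / (1 - r)) ^+ 2.
  rewrite -(parseval (fun q => r ^+ q.+1) m i i hU).
  rewrite -(ExZ hU 2 tR) -[X in _ + X](Ex_cst U).
  rewrite -(ExD hU (tameZ 2 tR) (tame_cst _ _)); apply: Ex_le => //.
    apply: (@tame_cmod_sqr _ _ _ (\sum_(q < m) 1)).
      apply: cmeas_sum => q; apply: cmeasM; first exact: cmeas_cst.
      by apply: cmeas_Upow; apply: mxmeas_id.
    move=> M uM; apply: le_trans (cmod_sum _ _ _) _; apply: ler_sum => q _.
    rewrite cmodM cmod_toC ger0_norm ?exprn_ge0 ?(ltW r0) // -[leRHS]mulr1.
    by apply: ler_pM; rewrite ?cmod_ge0 ?exprn_ge0 ?exprn_ile1 ?Upow_le1 ?(ltW r0) ?(ltW r1).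
  by apply: tameD; [exact: tameZ|exact: tame_cst].
have E3 : (r ^+ l.+1) ^+ 2 * Ex U (fun M => cmod (Upow M l.+1 i i) ^+ 2) <=
    2 * Ex U (fun M => cmod (resolv M z i i - 1) ^+ 2) + 2 * (eps / (1 - r)) ^+ 2.
  apply: le_trans E2; rewrite (bigD1 (Ordinal lm)) //= lerDl.
  apply: sumr_ge0 => q _; rewrite mulr_ge0 ?sqr_ge0 //.
  by apply: Ex_ge0 => // [|M _]; [exact: tame_Upow|exact: sqr_ge0].
have E4 := diag_resolv_moment hU r1 zr ki.
apply: (le_trans (ler_wpM2l (ltW np) E3)).
rewrite mulrDr mulrCA.
have -> : n%:R * (2 * (eps / (1 - r)) ^+ 2) = (2 * n%:R)^-1.
  by rewrite /eps; field; rewrite !gt_eqF.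
have : (2 * n%:R)^-1 <= 1 :> R.
  by rewrite invf_le1 ?mulr_gt0 // -natrM ler1n muln_gt0.
lra.
Qed.

(** * Pigeonhole *)

(** The interval [[-b, b]] is cut into pieces of length [e], and two indices whose coordinates all
    fall into the same pieces are close. *)
Lemma pigeonhole_close (R : realType) (J I : finType) (G : {set J})
    (x : J -> I -> R) (b e : R) :
  0 < e -> 0 <= b -> (forall j i, j \in G -> `|x j i| <= b) ->
  ((Num.truncn (2 * b / e)).+2 ^ #|I| < #|G|)%N ->
  exists j k, [/\ j \in G, k \in G, j != k & forall i, `|x j i - x k i| <= e].
Proof.
move=> e0 b0 xb cG; set B := (Num.truncn (2 * b / e)).+1 in cG.
pose y j i := (x j i + b) / e.
pose f j : {ffun I -> 'I_B.+1} := [ffun i => inord (Num.truncn (y j i))].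
have yb j i : j \in G -> 0 <= y j i <= 2 * b / e.
  move=> jG; have := xb j i jG; rewrite ler_norml => /andP[h1 h2].
  apply/andP; split; first by apply: divr_ge0 (ltW e0); lra.
  by apply: ler_wpM2r; [rewrite invr_ge0 ltW|lra].
have [j [k [jG kG jk fjk]]] : exists j k, [/\ j \in G, k \in G, j != k & f j = f k].
  apply: contrapT => H; have inj : {in G &, injective f}.
    move=> j k jG kG fjk; apply/eqP; apply: contrapT => /negP jk.
    by apply: H; exists j, k.
  have := card_in_imset inj; have := max_card (mem (f @: G)).
  by rewrite card_ffun card_ord => h1 h2; move: cG; rewrite -h2 ltnNge h1.
exists j, k; split => // i.
have := congr1 (fun g : {ffun I -> 'I_B.+1} => g i : nat) fjk.
have tb l : l \in G -> (Num.truncn (y l i) < B.+1)%N.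
  move=> lG; have /andP[y0 y1] := yb l i lG.
  by rewrite ltnS ltnW // ltnS le_truncn.
rewrite /= !ffunE !inordK ?tb // => te.
have /andP[yj0 _] := yb j i jG; have /andP[yk0 _] := yb k i kG.
have := truncn_itv yj0; have := truncn_itv yk0; rewrite te -!natr1.
move=> /andP[h1 h2] /andP[h3 h4].
have -> : x j i - x k i = (y j i - y k i) * e.
  by rewrite /y; field; rewrite gt_eqF.
rewrite normrM (gtr0_norm e0) ler_piMl ?(ltW e0) // ler_norml; lra.
Qed.

(* [sqrt n c^k |a_k| <= q^k (n r^(2k) |a_k|^2 + 1)] with [q = c / r] trades first
   moments of the coefficients for second moments. *)
Definition wterm (R : realType) n (q r : R) (l : nat) (M : 'M[Cplx R]_n.+1) i j : R :=
  q ^+ l.+1 * (n%:R * ((r ^+ l.+1) ^+ 2 * cmod (Upow M l.+1 i j) ^+ 2) + 1).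

Definition wsum (R : realType) n (q r : R) K m (M : 'M[Cplx R]_n.+1) i j : R :=
  \sum_(l < m | (K <= l)%N) wterm q r l M i j.

Lemma wterm_ge0 (R : realType) n (q r : R) l (M : 'M[Cplx R]_n.+1) i j :
  0 <= q -> 0 <= wterm q r l M i j.
Proof.
move=> q0; rewrite mulr_ge0 ?exprn_ge0 // addr_ge0 // mulr_ge0 //.
by rewrite mulr_ge0 ?sqr_ge0.
Qed.

Lemma wsum_ge0 (R : realType) n (q r : R) K m (M : 'M[Cplx R]_n.+1) i j :
  0 <= q -> 0 <= wsum q r K m M i j.
Proof. by move=> q0; apply: sumr_ge0 => l _; apply: wterm_ge0. Qed.

Lemma wterm_ge (R : realType) n (c r : R) l (M : 'M[Cplx R]_n.+1) i j :
  0 < c -> 0 < r ->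
  Num.sqrt n%:R * (c ^+ l.+1 * cmod (Upow M l.+1 i j)) <= wterm (c / r) r l M i j.
Proof.
move=> c0 r0; set a := cmod _; pose y := Num.sqrt n%:R * (r ^+ l.+1 * a).
have y2 : n%:R * ((r ^+ l.+1) ^+ 2 * a ^+ 2) = y ^+ 2.
  by rewrite /y exprMn sqr_sqrtr // exprMn.
rewrite /wterm y2.
have -> : Num.sqrt n%:R * (c ^+ l.+1 * a) = (c / r) ^+ l.+1 * y.
  rewrite /y exprMn exprVn; field.
  by rewrite expf_neq0 // gt_eqF.
apply: ler_wpM2l; first by rewrite exprn_ge0 // divr_ge0 // ltW.
have : 0 <= (y - 2^-1) ^+ 2 by apply: sqr_ge0.
lra.
Qed.

Lemma tame_wterm (R : realType) n (q r : R) l i j :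
  tame (fun M : 'M[Cplx R]_n.+1 => wterm q r l M i j).
Proof.
apply: tameZ; apply: tameD; last exact: tame_cst.
by apply: tameZ; apply: tameZ; apply: tame_Upow.
Qed.

Lemma tame_wsum (R : realType) n (q r : R) K m i j :
  tame (fun M : 'M[Cplx R]_n.+1 => wsum q r K m M i j).
Proof.
rewrite /wsum; under eq_fun do rewrite big_mkcond.
by apply: tame_sum => l; case: (K <= l)%N; [exact: tame_wterm|exact: tame_cst].
Qed.

Lemma geometric_tail (R : realType) (q : R) K m : 0 <= q < 1 ->
  \sum_(l < m | (K <= l)%N) q ^+ l.+1 <= q ^+ K / (1 - q).
Proof.
move=> /andP[q0 q1]; have q1' : 0 < 1 - q by rewrite subr_gt0.
apply: (@le_trans _ _ (\sum_(l < m | (K <= l)%N) q ^+ l)).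
  by apply: ler_sum => l _; rewrite exprS ler_piMl ?exprn_ge0 // ltW.
rewrite ler_pdivlMr //.
(* The telescoped geometric sum; the exponent [maxn K m] treats the empty range [m <= K] along with
   the others. *)
suff E : (\sum_(l < m | (K <= l)%N) q ^+ l) * (1 - q) + q ^+ (maxn K m) = q ^+ K.
  by rewrite -[leRHS]E lerDl exprn_ge0.
elim: m => [|m IH]; first by rewrite big_ord0 mul0r add0r maxn0.
rewrite big_mkcond big_ord_recr -big_mkcond /=; case: leqP => Km.
  move: IH; rewrite (maxn_idPr Km) (maxn_idPr (leqW Km)) exprS => <-; ring.
by move: IH; rewrite addr0 (maxn_idPl Km) (maxn_idPl (ltnW Km)).
Qed.

Lemma Ex_wsum d (T : measurableType d) (R : realType) (P : probability T R)
    n (U : {RV P >-> cmx R n.+1 n.+1}) (q r : R) K m i j :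
  haar_unitary U -> (0 < n)%N -> 0 < r < 1 -> 0 <= q < 1 ->
  Ex U (fun M => wsum q r K m M i j) <= (3 * Cvar r + 1) * (q ^+ K / (1 - q)).
Proof.
move=> hU n0 r01 q01; have /andP[q0 q1] := q01; have /andP[r0 r1] := r01.
have C1 := Cvar_ge1 r1.
rewrite /wsum; under [X in Ex U X]eq_fun do rewrite big_mkcond.
rewrite Ex_sum // => [|l]; last first.
  by case: (K <= l)%N; [exact: tame_wterm|exact: tame_cst].
apply: (@le_trans _ _ ((3 * Cvar r + 1) * \sum_(l < m | (K <= l)%N) q ^+ l.+1)).
  rewrite [X in _ <= _ * X]big_mkcond mulr_sumr; apply: ler_sum => l _.
  case: (K <= l)%N; last by rewrite Ex_cst mulr0.
  have tU := tame_Upow R l.+1 i j.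
  rewrite /wterm ExZ //; last first.
    by apply: tameD; [do 2 apply: tameZ|apply: tame_cst].
  rewrite ExD //; last 2 first.
  - by do 2 apply: tameZ.
  - exact: tame_cst.
  rewrite Ex_cst ExZ; [|by []|exact: tameZ].
  rewrite ExZ // mulrC ler_wpM2r ?exprn_ge0 // lerD2r.
  exact: Upow_moment.
by apply: ler_wpM2l; [lra|apply: geometric_tail].
Qed.

(** For [|z| <= c] this dominates [sqrt n |R_0i - R_0j|] up to the Neumann remainder of order [n],
    for indices different from 0; it no longer depends on [z]. *)
Definition rowgap (R : realType) n (c : R) (M : 'M[Cplx R]_n.+1) (i j : 'I_n.+1) : R :=
  \sum_(l < n) Num.sqrt n%:R *
    (c ^+ l.+1 * cmod (Upow M l.+1 ord0 i - Upow M l.+1 ord0 j)).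

Definition wtotal (R : realType) n (q r : R) L (M : 'M[Cplx R]_n.+1) : R :=
  \sum_(p : 'I_L.+1 * 'I_L.+1) wsum q r 0 n M (inord p.1) (inord p.2).

(** A column whose whole weighted sum reaches [H], or whose tail from [K] on reaches [eps],
    contributes at least 1. Thus [badness] bounds the number of bad columns and has an expectation
    that is easy to control. *)
Definition badness (R : realType) n (q r H eps : R) K L (M : 'M[Cplx R]_n.+1) : R :=
  \sum_(j < L) (H^-1 * wsum q r 0 n M ord0 (inord j.+1)
              + eps^-1 * wsum q r K n M ord0 (inord j.+1)).

Lemma wsumS (R : realType) n (q r : R) K m (M : 'M[Cplx R]_n.+1) i j (l : 'I_m) :
  0 <= q -> (K <= l)%N -> wterm q r l M i j <= wsum q r K m M i j.
Proof.
move=> q0 Kl; rewrite /wsum (bigD1 l) //= lerDl.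
by apply: sumr_ge0 => k _; apply: wterm_ge0.
Qed.

(** More than half of the columns are good, which by the choice of [L] exceeds the number of boxes
    for the [2K] real coordinates of the first [K] coefficients. In the resulting pair the two tails
    contribute at most [2 eps] and the first [K] coefficients at most [eps]. *)
Lemma close_pair (R : realType) n (c r H eps : R) K L (M : 'M[Cplx R]_n.+1) :
  0 < c -> 0 < r -> 0 < H -> 0 < eps -> (K <= n)%N ->
  (2 * (Num.truncn (2 * H / (eps / (2 * K%:R + 1)))).+2 ^ (K * 2) <= L)%N ->
  badness (c / r) r H eps K L M < L%:R / 2 ->
  exists j k : 'I_L, j != k /\ rowgap c M (inord j.+1) (inord k.+1) <= 3 * eps.
Proof.
move=> c0 r0 H0 eps0 Kn hL hbad; set q := c / r in hbad.
have q0 : 0 <= q by rewrite divr_ge0 // ltW.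
have K0 : 0 <= K%:R :> R by [].
(* Real and imaginary parts of [K] differences add up to at most [2 K e <= eps]; the 1 in the
   denominator keeps it positive when [K = 0]. *)
set e := eps / (2 * K%:R + 1) in hL.
have e0 : 0 < e by rewrite divr_gt0 //; lra.
pose i (j : 'I_L) : 'I_n.+1 := inord j.+1.
pose G := finset (fun j : 'I_L =>
  (wsum q r 0 n M ord0 (i j) < H) && (wsum q r K n M ord0 (i j) < eps)).
pose x j (u : 'I_K * bool) : R := Num.sqrt n%:R * (c ^+ u.1.+1 *
  (if u.2 then complex.Re (Upow M u.1.+1 ord0 (i j))
   else complex.Im (Upow M u.1.+1 ord0 (i j)))).
have s0 : 0 <= Num.sqrt n%:R :> R by apply: sqrtr_ge0.
have xb j u : j \in G -> `|x j u| <= H.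
  rewrite inE => /andP[/ltW h _]; apply: le_trans h; case: u => l b.
  pose l' : 'I_n := widen_ord Kn l.
  apply: le_trans (@wsumS _ _ q r 0 n M ord0 (i j) l' q0 (leq0n _)).
  apply: le_trans (wterm_ge l M ord0 (i j) c0 r0).
  rewrite /x normrM (ger0_norm s0); apply: ler_wpM2l => //.
  rewrite normrM ger0_norm ?exprn_ge0 ?(ltW c0) //.
  apply: ler_wpM2l; first by rewrite exprn_ge0 ?(ltW c0).
  by case: b => /=; [exact: Re_le_cmod|exact: Im_le_cmod].
have cG : ((Num.truncn (2 * H / e)).+2 ^ #|{: 'I_K * bool}| < #|G|)%N.
  rewrite card_prod card_ord card_bool -(ltn_pmul2l (isT : 0 < 2)%N).
  apply: leq_ltn_trans hL _.
  have hC : #|~: G|%:R <= badness q r H eps K L M.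
    rewrite -sum1_card natr_sum big_mkcond /=; apply: ler_sum => j _.
    rewrite !inE -/(i j).
    have w1 := wsum_ge0 r 0 n M ord0 (i j) q0.
    have w2 := wsum_ge0 r K n M ord0 (i j) q0.
    have w1' : 0 <= H^-1 * wsum q r 0 n M ord0 (i j).
      by rewrite mulr_ge0 // invr_ge0 ltW.
    have w2' : 0 <= eps^-1 * wsum q r K n M ord0 (i j).
      by rewrite mulr_ge0 // invr_ge0 ltW.
    case: ltP => h1 /=; last first.
      have : 1 <= H^-1 * wsum q r 0 n M ord0 (i j) by rewrite mulrC ler_pdivlMr // mul1r.
      lra.
    case: ltP => h2 /=; first by lra.
    have : 1 <= eps^-1 * wsum q r K n M ord0 (i j) by rewrite mulrC ler_pdivlMr // mul1r.
    lra.
  have := cardsC G; rewrite card_ord => LE.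
  have : #|~: G|%:R * 2 < L%:R :> R by move: (le_lt_trans hC hbad); lra.
  rewrite -natrM ltr_nat -[X in (_ < X)%N]LE muln2 -addnn ltn_add2r => hG.
  by rewrite -[X in (X < _)%N]LE mul2n -addnn ltn_add2l.
have [j [k [jG kG jk hx]]] := pigeonhole_close e0 (ltW H0) xb cG.
exists j, k; split => //.
move: jG kG; rewrite !inE => /andP[_ tj] /andP[_ tk].
rewrite /rowgap (bigID (fun l : 'I_n => (K <= l)%N)) /= -/(i j) -/(i k).
have h1 : \sum_(l < n | (K <= l)%N) Num.sqrt n%:R *
    (c ^+ l.+1 * cmod (Upow M l.+1 ord0 (i j) - Upow M l.+1 ord0 (i k))) <=
    wsum q r K n M ord0 (i j) + wsum q r K n M ord0 (i k).
  rewrite /wsum -big_split /=; apply: ler_sum => l _.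
  have g1 := wterm_ge l M ord0 (i j) c0 r0; have g2 := wterm_ge l M ord0 (i k) c0 r0.
  apply: le_trans (lerD g1 g2); rewrite -mulrDr -mulrDr.
  apply: ler_wpM2l => //; apply: ler_wpM2l; first by rewrite exprn_ge0 ?(ltW c0).
  exact: cmodB.
have h2 : \sum_(l < n | ~~ (K <= l)%N) Num.sqrt n%:R *
    (c ^+ l.+1 * cmod (Upow M l.+1 ord0 (i j) - Upow M l.+1 ord0 (i k))) <=
    K%:R * (2 * e).
  under eq_bigl => l do rewrite -ltnNge.
  rewrite (big_ord_narrow Kn) /= mulr_natl -[in leRHS](card_ord K) -sumr_const.
  apply: ler_sum => l _.
  have := hx (l, true); have := hx (l, false); rewrite /x /= -!mulrBr -!raddfB /=.
  set a := Upow _ _ _ _ - _ => ha hb.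
  apply: (@le_trans _ _ (Num.sqrt n%:R * (c ^+ l.+1 * (`|complex.Re a| + `|complex.Im a|)))).
    apply: ler_wpM2l => //; apply: ler_wpM2l; last exact: cmod_le_ReIm.
    by rewrite exprn_ge0 ?(ltW c0).
  move: ha hb; rewrite !normrM (ger0_norm s0) (ger0_norm (exprn_ge0 _ (ltW c0))).
  lra.
have h3 : K%:R * (2 * e) <= eps.
  rewrite /e mulrA mulrA ler_pdivrMr; last by lra.
  by have : 0 <= K%:R * eps by [rewrite mulr_ge0 // ltW]; lra.
lra.
Qed.

(** * A pair of columns that is close with probability bounded below *)

Lemma measure_bigU_le d (T : measurableType d) (R : realType) (P : probability T R)
    I (s : seq I) (Q : pred I) (F : I -> set T) :
  (forall i, measurable (F i)) ->
  (P (\big[setU/set0]_(i <- s | Q i) F i) <= \sum_(i <- s | Q i) P (F i))%E.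
Proof.
move=> mF; elim: s => [|a s IH]; first by rewrite !big_nil measure0.
rewrite !big_cons; case: (Q a) => //.
apply: le_trans (leeD2l _ IH).
by apply: measureU2 => //; apply: bigsetU_measurable.
Qed.

Lemma tame_badness (R : realType) n (q r H eps : R) K L :
  tame (@badness R n q r H eps K L).
Proof.
by apply: tame_sum => j; apply: tameD; apply: tameZ; apply: tame_wsum.
Qed.

Lemma tame_wtotal (R : realType) n (q r : R) L : tame (@wtotal R n q r L).
Proof. by apply: tame_sum => p; apply: tame_wsum. Qed.

Lemma measurable_rowgap (R : realType) n (c : R) i j :
  measurable_fun [set: cmx R n.+1 n.+1]
    ((fun M => rowgap c M i j) : cmx R n.+1 n.+1 -> R).
Proof.
apply: measurable_sum => l; apply: measurable_funM; first exact: measurable_cst.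
apply: measurable_funM; first exact: measurable_cst.
by apply: measurable_cmod; apply: cmeasB; apply: cmeas_Upow; apply: mxmeas_id.
Qed.

Lemma measurable_le_cst (R : realType) n (f : cmx R n n -> R) (b : R) :
  measurable_fun [set: cmx R n n] f -> measurable [set M | f M <= b].
Proof.
move=> mf; rewrite (_ : [set M | _] = f @^-1` `]-oo, b]%classic).
  by rewrite -[X in measurable X]setTI; apply: mf.
by apply/seteqP; split => w /=; rewrite in_itv.
Qed.

Definition pairset (R : realType) n (c q r M1 eps : R) L (j k : nat) :
    set (cmx R n.+1 n.+1) :=
  [set M | wtotal q r L M <= M1] `&`
  [set M | rowgap c M (inord j.+1) (inord k.+1) <= 3 * eps].

Lemma measurable_pairset (R : realType) n (c q r M1 eps : R) L j k :
  measurable (@pairset R n c q r M1 eps L j k).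
Proof.
apply: measurableI; apply: measurable_le_cst; first exact: (tame_wtotal n q r L).1.
exact: measurable_rowgap.
Qed.

(** If every pair had probability below [1/(8 L^2)], the space would be covered by three events of
    total probability at most [1/2 + 1/4 + 1/8 < 1]: too many bad columns, too large entries, or a
    close pair. The first two bounds are Markov's inequality, [H] and [eps] being such that the mean
    of [badness] is at most [L/4], and the bound on [wtotal] being four times its mean. *)
Lemma pair_prob d (T : measurableType d) (R : realType) (P : probability T R)
    n (U : {RV P >-> cmx R n.+1 n.+1}) (c r eps : R) K L :
  let q := c / r in let C := 3 * Cvar r + 1 in let H := 8 * C / (1 - q) in
  haar_unitary U -> (0 < n)%N -> 0 < c -> c < r -> r < 1 -> 0 < eps ->
  C * (q ^+ K / (1 - q)) <= eps / 8 -> (K <= n)%N ->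
  (2 * (Num.truncn (2 * H / (eps / (2 * K%:R + 1)))).+2 ^ (K * 2) <= L)%N ->
  exists j k : 'I_L, j != k /\
    (((8 * L%:R ^+ 2)^-1)%:E <=
     P (U @^-1` pairset c q r (4 * L.+1%:R ^+ 2 * (C / (1 - q))) eps L j k))%E.
Proof.
move=> q C H hU n0 c0 cr r1 eps0 hK Kn hL; apply: contrapT => hno.
set M1 := 4 * _ * _ in hno.
have r0 : 0 < r by lra.
have q0 : 0 < q by rewrite divr_gt0.
have q1 : q < 1 by rewrite ltr_pdivrMr // mul1r.
have q01 : 0 <= q < 1 by rewrite (ltW q0).
have r01 : 0 < r < 1 by rewrite r0.
have q1' : 0 < 1 - q by rewrite subr_gt0.
have C0 : 0 < C by have := Cvar_ge1 r1; rewrite /C; lra.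
have Cq0 : 0 < C / (1 - q) by rewrite divr_gt0.
have H0 : 0 < H by rewrite /H -mulrA mulr_gt0.
have L0 : (0 < L)%N by apply: leq_trans hL; rewrite muln_gt0 expn_gt0.
have L0' : 0 < L%:R :> R by rewrite ltr0n.
have head i j : Ex U (fun M => wsum q r 0 n M i j) <= C / (1 - q).
  apply: le_trans (Ex_wsum 0 n i j hU n0 r01 q01) _.
  by rewrite expr0 mul1r.
have Ebad : Ex U (badness q r H eps K L) <= L%:R / 4.
  rewrite /badness Ex_sum // => [|j]; last first.
    by apply: tameD; apply: tameZ; apply: tame_wsum.
  have -> : L%:R / 4 = \sum_(j < L) (4^-1 : R).
    by rewrite sumr_const card_ord mulr_natl.
  apply: ler_sum => j _.
  rewrite ExD ?ExZ //; try (exact: tame_wsum); try (apply: tameZ; exact: tame_wsum).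
  have h1 : H^-1 * Ex U (fun M => wsum q r 0 n M ord0 (inord j.+1)) <= 8^-1.
    rewrite mulrC ler_pdivrMr //; apply: le_trans (head _ _) _.
    by rewrite /H; lra.
  have h2 : eps^-1 * Ex U (fun M => wsum q r K n M ord0 (inord j.+1)) <= 8^-1.
    rewrite mulrC ler_pdivrMr //; apply: le_trans (Ex_wsum K n _ _ hU n0 r01 q01) _.
    by apply: le_trans hK _; lra.
  lra.
have Etot : Ex U (wtotal q r L) <= L.+1%:R ^+ 2 * (C / (1 - q)).
  rewrite /wtotal Ex_sum // => [|p]; last exact: tame_wsum.
  have -> : L.+1%:R ^+ 2 * (C / (1 - q)) = \sum_(p : 'I_L.+1 * 'I_L.+1) (C / (1 - q)).
    by rewrite sumr_const card_prod card_ord -[RHS]mulr_natl natrM expr2.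
  by apply: ler_sum => p _; apply: head.
have bad0 (M : 'M[Cplx R]_n.+1) : M \is unitarymx -> 0 <= badness q r H eps K L M.
  move=> _; apply: sumr_ge0 => j _.
  by rewrite addr_ge0 // mulr_ge0 ?wsum_ge0 ?invr_ge0 ?(ltW H0) ?(ltW eps0) ?(ltW q0).
have tot0 (M : 'M[Cplx R]_n.+1) : M \is unitarymx -> 0 <= wtotal q r L M.
  by move=> _; apply: sumr_ge0 => p _; apply: wsum_ge0; apply: ltW.
have M10 : 0 < M1 by rewrite /M1 mulr_gt0 // mulr_gt0 // exprn_gt0 // ltr0n.
pose A := [set w : T | L%:R / 2 <= badness q r H eps K L (U w)].
pose B := [set w : T | M1 <= wtotal q r L (U w)].
have PA : (P A <= (2^-1)%:E)%E.
  have L20 : 0 < L%:R / 2 :> R by rewrite divr_gt0.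
  have := Ex_markov hU (tame_badness n q r H eps K L) bad0 L20.
  move=> /le_trans; apply; rewrite lee_fin ler_pdivrMr //.
  by apply: le_trans Ebad _; lra.
have PB : (P B <= (4^-1)%:E)%E.
  have := Ex_markov hU (tame_wtotal n q r L) tot0 M10.
  move=> /le_trans; apply; rewrite lee_fin ler_pdivrMr //.
  by apply: le_trans Etot _; rewrite /M1; lra.
have mge (f : 'M[Cplx R]_n.+1 -> R) b : tame f -> measurable [set w : T | b <= f (U w)].
  move=> tf; rewrite (_ : [set w | _] = (fun w => f (U w)) @^-1` `[b, +oo[%classic).
    by rewrite -[X in measurable X]setTI; apply: (measurable_phiU U tf.1).
  by apply/seteqP; split => w /=; rewrite in_itv /= andbT.
have mA : measurable A by apply: mge; apply: tame_badness.
have mB : measurable B by apply: mge; apply: tame_wtotal.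
pose G (p : 'I_L * 'I_L) : set T := U @^-1` pairset c q r M1 eps L p.1 p.2.
have mG p : measurable (G p).
  by rewrite -[X in measurable X]setTI; apply: measurable_funP => //; apply: measurable_pairset.
pose GG := \big[setU/set0]_(p : 'I_L * 'I_L | p.1 != p.2) G p.
have mGG : measurable GG by apply: bigsetU_measurable => p _.
have PG : (P GG <= (8^-1)%:E)%E.
  apply: le_trans (measure_bigU_le P _ _ mG) _.
  apply: (@le_trans _ _ (\sum_(p : 'I_L * 'I_L) ((8 * L%:R ^+ 2)^-1)%:E)%E).
    rewrite big_mkcond /=; apply: lee_sum => p _; case: ifP => pp; last first.
      by rewrite lee_fin invr_ge0 mulr_ge0 ?sqr_ge0.
    rewrite leNgt; apply/negP => h; apply: hno.
    by exists p.1, p.2; split => //; apply: ltW.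
  rewrite sumEFin lee_fin sumr_const card_prod card_ord -[leLHS]mulr_natl natrM.
  by rewrite invfM mulrCA -expr2 mulfV ?mulr1 // expf_neq0 // gt_eqF.
have cover : [set: T] `<=` A `|` B `|` GG.
  move=> w _.
  have [hA|hA] := leP (L%:R / 2) (badness q r H eps K L (U w)); first by left; left.
  have [hB|hB] := leP M1 (wtotal q r L (U w)); first by left; right.
  right; have [j [k [jk hg]]] := close_pair c0 r0 H0 eps0 Kn hL hA.
  rewrite /GG (bigD1 (j, k)) //=; left; split => //=; exact: ltW.
have : (1%:E <= (2^-1)%:E + (4^-1)%:E + (8^-1)%:E :> \bar R)%E.
  rewrite -(probability_setT P).
  apply: (@le_trans _ _ (P (A `|` B `|` GG))).
    by apply: le_measure => //; rewrite inE //; apply: measurableU => //; apply: measurableU.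
  apply: le_trans (measureU2 _ _ _) _ => //; first exact: measurableU.
  apply: leeD => //; apply: le_trans (measureU2 _ _ _) _ => //.
  exact: leeD.
by rewrite -!EFinD lee_fin; lra.
Qed.

(** The order of choices matters: [K] makes the tails small, [L] provides enough columns, the bound
    [M1] on the entries depends on [L], and [n0] comes last. Hence [p = 1/(8 L^2)] depends only on
    [c] and [eps0], while [W] and [G] may depend on [n] and on the law of [U]. *)
Lemma swap_good (R : realType) (c eps0 : R) : 0 < c < 1 -> 0 < eps0 ->
  exists (p : R) (n0 : nat), 0 < p /\ forall n, (n0 <= n)%N ->
  forall d (T : measurableType d) (P : probability T R)
    (U : {RV P >-> cmx R n.+1 n.+1}), haar_unitary U ->
  exists (W : 'M[Cplx R]_n.+1) (G : set (cmx R n.+1 n.+1)),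
  [/\ W \is unitarymx, measurable G, (p%:E <= P (U @^-1` G))%E &
   forall M, M \is unitarymx -> G M -> forall z, cmod z <= c ->
     Num.sqrt n%:R * cmod (resolv (W *m M) z ord0 ord0 - 1) <= eps0].
Proof.
move=> /andP[c0 c1] e0.
pose r := (1 + c) / 2; pose q := c / r; pose C := 3 * Cvar r + 1.
(* The 11 anticipates the final sum: the gap of [5 eps], made of [3 eps] from the pair and [2 eps]
   from two remainders, is doubled by the exchange, and the quadratic error adds one more [eps]. *)
pose H := 8 * C / (1 - q); pose eps := eps0 / 11.
have cr : c < r by rewrite /r; lra.
have r1 : r < 1 by rewrite /r; lra.
have r0 : 0 < r by lra.
have q0 : 0 < q by rewrite divr_gt0.
have q1 : q < 1 by rewrite ltr_pdivrMr // mul1r.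
have q1' : 0 < 1 - q by rewrite subr_gt0.
have c1' : 0 < 1 - c by rewrite subr_gt0.
have C0 : 0 < C by have := Cvar_ge1 r1; rewrite /C; lra.
have eps1 : 0 < eps by rewrite divr_gt0.
have q01 : 0 <= q < 1 by rewrite (ltW q0).
have c01 : 0 <= c < 1 by rewrite (ltW c0).
have d0 : 0 < eps / 8 * (1 - q) / C by rewrite divr_gt0 // mulr_gt0 // divr_gt0.
have [K hK] := expr_small q01 d0.
have hK' : C * (q ^+ K / (1 - q)) <= eps / 8.
  rewrite mulrA ler_pdivrMr // mulrC -ler_pdivlMr //; exact: hK.
pose L := (2 * (Num.truncn (2 * H / (eps / (2 * K%:R + 1)))).+2 ^ (K * 2))%N.
have L0 : (0 < L)%N by rewrite muln_gt0 expn_gt0.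
pose M1 := 4 * L.+1%:R ^+ 2 * (C / (1 - q)).
have M10 : 0 < M1.
  by rewrite /M1 mulr_gt0 ?divr_gt0 // mulr_gt0 // exprn_gt0 // ltr0n.
have [n1 hn1] := natr_expr_small c01 (mulr_gt0 eps1 c1').
(* Once [sqrt n >= X], the first summand makes the entries at most [1/16] away from the identity,
   and the second makes the quadratic error at most [eps]. *)
pose X := 16 * (M1 + eps) + 16 * (M1 + eps) ^+ 2 / eps.
have ME0 : 0 < M1 + eps by rewrite addr_gt0.
have X1 : 0 <= 16 * (M1 + eps) by apply: mulr_ge0 (ltW ME0).
have X2 : 0 <= 16 * (M1 + eps) ^+ 2 / eps.
  by apply: divr_ge0 (ltW eps1); apply: mulr_ge0 (sqr_ge0 _).
have X0 : 0 <= X by apply: addr_ge0.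
pose n2 := (Num.truncn (X ^+ 2)).+1.
exists (8 * L%:R ^+ 2)^-1, (maxn (maxn K L) (maxn n1 n2)); split.
  by rewrite invr_gt0 mulr_gt0 // exprn_gt0 // ltr0n.
move=> n; rewrite !geq_max => /andP[/andP[Kn Ln] /andP[n1n n2n]] d T P U hU.
have n0 : (0 < n)%N by apply: leq_trans Ln.
have [j [k [jk hP]]] := pair_prob hU n0 c0 cr r1 eps1 hK' Kn (leqnn L).
pose o : 'I_n.+1 := ord0; pose a : 'I_n.+1 := inord j.+1; pose b : 'I_n.+1 := inord k.+1.
have jn : (j.+1 < n.+1)%N by rewrite ltnS; apply: leq_trans Ln; apply: ltn_ord.
have kn : (k.+1 < n.+1)%N by rewrite ltnS; apply: leq_trans Ln; apply: ltn_ord.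
have oa : o != a by apply/eqP => /(congr1 val); rewrite /= inordK.
have ob : o != b by apply/eqP => /(congr1 val); rewrite /= inordK.
have ab : a != b.
  apply: contra jk => /eqP /(congr1 val); rewrite /= !inordK // => -[jk].
  by apply/eqP/val_inj.
exists (swapmx (delta_mx o 0) (diffvec R a b)),
  (pairset c q r M1 eps L j k); split => //.
- by apply: swapmx_unitary; apply: orthonormal2_diffvec.
- exact: measurable_pairset.
move=> M uM [/= htot hgap] z zc; have z1 := le_lt_trans zc c1.
have np : 0 < n%:R :> R by rewrite ltr0n.
pose s : R := Num.sqrt n%:R.
have s0 : 0 < s by rewrite sqrtr_gt0.
have sn : s <= n%:R.
  have s2 : s ^+ 2 = n%:R by rewrite sqr_sqrtr // ltW.
  have : 1 <= s by rewrite -sqrtr1 ler_sqrt ?ler1n.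
  rewrite -s2; nra.
have Xs : X <= s.
  rewrite -(ger0_norm X0) -sqrtr_sqr; apply: ler_wsqrtr.
  apply: le_trans (_ : n2%:R <= n%:R); last by rewrite ler_nat.
  by have /andP[_ /ltW] := truncn_itv (sqr_ge0 X).
have rem : s * (c ^+ n.+1 / (1 - c)) <= eps.
  rewrite mulrA ler_pdivrMr //; apply: le_trans (hn1 n n1n).
  rewrite exprS; apply: ler_pM => //; rewrite ?mulr_ge0 ?exprn_ge0 ?(ltW c0) ?(ltW s0) //.
  by rewrite ler_piMl ?exprn_ge0 ?(ltW c0) ?(ltW c1).
have idx i : i \in [:: o; a; b] -> exists i' : 'I_L.+1, i = inord i'.
  rewrite !inE => /or3P[] /eqP ->.
  - by exists ord0; apply: val_inj; rewrite /= inordK.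
  - by exists (Ordinal (ltn_ord j : (j.+1 < L.+1)%N)).
  - by exists (Ordinal (ltn_ord k : (k.+1 < L.+1)%N)).
have close i l : i \in [:: o; a; b] -> l \in [:: o; a; b] ->
    cmod (resolv M z i l - (i == l)%:R) <= (M1 + eps) / s.
  move=> hi hl; rewrite ler_pdivlMr // mulrC.
  apply: (le_trans (ler_wpM2l (ltW s0) (resolv_entry_close n i l uM c1 zc))).
  rewrite mulrDr; apply: lerD => //; apply: le_trans htot.
  have [i' ->] := idx i hi; have [l' ->] := idx l hl.
  rewrite /wtotal (bigD1 (i', l')) //= -[leLHS]addr0; apply: lerD.
    rewrite /wsum mulr_sumr; apply: ler_sum => m _; exact: wterm_ge.
  by apply: sumr_ge0 => p _; apply: wsum_ge0; apply: ltW.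
have gap : cmod (resolv M z o a - resolv M z o b) <= (5 * eps) / s.
  rewrite ler_pdivlMr // mulrC.
  apply: (le_trans (ler_wpM2l (ltW s0) (resolv_row_diff n uM c1 zc oa ob))).
  rewrite mulrDr; have : s * (2 * (c ^+ n.+1 / (1 - c))) <= 2 * eps.
    by rewrite mulrCA ler_wpM2l.
  have -> : s * (\sum_(l < n) c ^+ l.+1 * cmod (Upow M l.+1 o a - Upow M l.+1 o b))
    = rowgap c M a b by rewrite mulr_sumr.
  move: hgap; rewrite -/a -/b; lra.
have e16 : (M1 + eps) / s <= 16^-1.
  rewrite ler_pdivrMr // mulrC ler_pdivlMr // mulrC; apply: le_trans Xs.
  by rewrite /X lerDl.
have := resolv_swap_diffvec uM z1 oa ob ab e16 close gap.
rewrite bil_delta => h; apply: (le_trans (ler_wpM2l (ltW s0) h)).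
have sneq : s != 0 by rewrite gt_eqF.
have -> : s * (16 * ((M1 + eps) / s) ^+ 2 + 2 * (5 * eps / s)) =
  16 * (M1 + eps) ^+ 2 / s + 10 * eps by field.
have : 16 * (M1 + eps) ^+ 2 / s <= eps.
  rewrite ler_pdivrMr // [leRHS]mulrC -ler_pdivrMr //; apply: le_trans Xs.
  by rewrite /X lerDr.
rewrite /eps; lra.
Qed.

(** * Discretization of the unit vector *)

(** Gram-Schmidt is applied to the matrix all of whose rows are [v^T]. Its first row spans the same
    line as [v^T], so they differ by a phase, which is put back as a scalar factor. *)
Lemma unit_vector_unitary (R : realType) n (v : 'cV[Cplx R]_n.+1) :
  is_unit_vector v -> exists2 V : 'M[Cplx R]_n.+1,
    V \is unitarymx & V *m delta_mx 0 0 = v.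
Proof.
move=> v1; pose A : 'M[Cplx R]_n.+1 := \matrix_(i, j) v j 0.
pose S := schmidt A.
have uS : S \is unitarymx by apply: schmidt_unitarymx.
have : (row 0 A <= row 0 S)%MS.
  have := row_schmidt_sub A 0.
  rewrite (big_pred1 0) ?genmxE // => k /=; rewrite leqn0.
  by apply/eqP/eqP => [k0|->//]; apply: val_inj.
move=> /sub_rVP[a aE].
have vE : v^T = a *: row 0 S by rewrite -aE; apply/rowP => j; rewrite !mxE.
have a1 : cmod a = 1.
  have := nsq_unit_vector v1; rewrite vE nsqZ rowE nsq_unitary // nsq_delta mulr1.
  by move/eqP; rewrite sqrp_eq1 ?cmod_ge0 // => /eqP.
exists (a%:M *m S^T).
  by apply: (mul_unitarymx (scalar_unitary _ a1)); rewrite trmx_unitary; exact: uS.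
rewrite mul_scalar_mx -scalemxAl -colE -tr_row -linearZ /= -vE trmxK //.
Qed.

(** The eigenvalue equation makes [v^* R v - 1] equal to [t / (1 - t) >= t]. Replacing [v] by the
    nearby vector [V e_0] costs the last term, and conjugation by [V] turns the remaining quadratic
    form into a diagonal entry. *)
Lemma perturbed_eigenvalue (R : realType) n (M V : 'M[Cplx R]_n.+1)
    (v : 'cV[Cplx R]_n.+1) (t c dlt : R) (z : Cplx R) :
  M \is unitarymx -> V \is unitarymx -> is_unit_vector v ->
  (forall i, cmod (v i 0 - (V *m (delta_mx 0 0 : 'cV_n.+1)) i 0) <= dlt) ->
  0 < t -> t < 1 -> c < 1 -> cmod z <= c ->
  z \in eigenvalues (rank_one_perturbation M v t) ->
  t <= cmod (resolv (V^t* *m M *m V) z 0 0 - 1)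
       + n.+1%:R ^+ 2 * (2 * dlt * (1 - c)^-1).
Proof.
move=> uM uV v1 vV t0 t1 c1 zc zE; have z1 := le_lt_trans zc c1.
have uV' : V^t* \is unitarymx by rewrite trmxC_unitary.
set e0 : 'cV[Cplx R]_n.+1 := delta_mx 0 0 in vV; set w := V *m e0 in vV.
have VV' : V^t* *m V = 1%:M.
  by have /unitarymxP := uV'; rewrite trmxCK.
have w1 : is_unit_vector w.
  rewrite /is_unit_vector /w trC_mul mulmxA -(mulmxA _ (V^t*)) VV' mulmx1.
  by rewrite bil1 bil_delta mxE eqxx.
have wE : bil (resolv M z) w w = resolv (V^t* *m M *m V) z 0 0.
  have := resolv_conj uM uV' z1; rewrite trmxCK => ->.
  by rewrite -[RHS]bil_delta /bil /w trC_mul !mulmxA.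
have vE := eigenvalues_resolv uM t1 z1 zE.
have b := bil_perturb v1 w1 (fun i j => resolv_entry i j uM c1 zc) vV.
rewrite -wE; apply: le_trans (lerD (lexx _) b).
rewrite vE; set B := bil _ w w.
have : cmod (toC (1 - t)^-1 - 1) <= cmod (B - 1) + cmod (toC (1 - t)^-1 - B).
  rewrite [leRHS]addrC; set X := toC _; have -> : X - 1 = (X - B) + (B - 1) by ring.
  exact: cmodD.
apply: le_trans.
have t1' : 0 < 1 - t by rewrite subr_gt0.
have -> : toC (1 - t)^-1 - 1 = toC (t / (1 - t)).
  have -> : t / (1 - t) = (1 - t)^-1 - 1 by field; rewrite gt_eqF.
  by rewrite /toC rmorphB.
rewrite cmod_toC ger0_norm ?divr_ge0 ?(ltW t0) ?(ltW t1') //.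
by rewrite ler_peMr ?(ltW t0) // invf_ge1 // gerBl ltW.
Qed.

Definition coordinate (R : realType) n (v : 'cV[Cplx R]_n) (u : 'I_n * bool) : R :=
  if u.2 then complex.Re (v u.1 0) else complex.Im (v u.1 0).

Lemma coordinate_le1 (R : realType) n (v : 'cV[Cplx R]_n) u :
  is_unit_vector v -> `|coordinate v u| <= 1.
Proof.
move=> v1; apply: le_trans (unit_vector_entry u.1 v1); rewrite /coordinate.
by case: u.2; [exact: Re_le_cmod|exact: Im_le_cmod].
Qed.

(** Half-open boxes in the real coordinates of [v], so that cells are both measurable and pairwise
    disjoint. *)
Definition cell (R : realType) n B (g : R) (k : {ffun 'I_n * bool -> 'I_B}) :
    set (cmx R n 1) :=
  [set v | forall u, (k u)%:R <= (coordinate v u + 1) / g < (k u).+1%:R].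

Lemma measurable_cell (R : realType) n B (g : R) (k : {ffun 'I_n * bool -> 'I_B}) :
  measurable (cell g k).
Proof.
have mc u : measurable_fun [set: cmx R n 1]
    ((fun v => (coordinate v u + 1) / g) : cmx R n 1 -> R).
  apply: measurable_funM; last exact: measurable_cst.
  apply: measurable_funD; last exact: measurable_cst.
  have [m1 m2] := cmeas_entry R u.1 (0 : 'I_1).
  by rewrite /coordinate; case: u.2; [exact: m1|exact: m2].
have -> : cell g k = \bigcap_(u in [set: 'I_n * bool])
    (((fun v => (coordinate v u + 1) / g) : cmx R n 1 -> R) @^-1`
      `[(k u)%:R, (k u).+1%:R[%classic).
  apply/seteqP; split => v hv u; last by have := hv u I; rewrite /= in_itv.
  by move=> _; have := hv u; rewrite /= in_itv.
apply: fin_bigcap_measurable; first exact: finite_finset.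
by move=> u _; rewrite -[X in measurable X]setTI; apply: mc.
Qed.

Lemma cell_inj (R : realType) n B (g : R) (k l : {ffun 'I_n * bool -> 'I_B})
    (v : cmx R n 1) : cell g k v -> cell g l v -> k = l.
Proof.
move=> hk hl; apply/ffunP => u; apply: val_inj.
have /andP[k1 k2] := hk u; have /andP[l1 l2] := hl u.
have := le_lt_trans k1 l2; have := le_lt_trans l1 k2.
by rewrite !ltr_nat !ltnS => h1 h2; apply/eqP; rewrite eqn_leq h1 h2.
Qed.

Lemma cell_cover (R : realType) n (g : R) (v : 'cV[Cplx R]_n) :
  0 < g -> is_unit_vector v ->
  exists k : {ffun 'I_n * bool -> 'I_(Num.truncn (2 / g)).+1}, cell g k v.
Proof.
move=> g0 v1; exists [ffun u => inord (Num.truncn ((coordinate v u + 1) / g))] => u.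
have := coordinate_le1 u v1; rewrite ler_norml => /andP[h1 h2].
have y0 : 0 <= (coordinate v u + 1) / g by apply: divr_ge0 (ltW g0); lra.
rewrite ffunE inordK; first exact: truncn_itv.
rewrite ltnS; apply: le_truncn; apply: ler_wpM2r; first by rewrite invr_ge0 ltW.
lra.
Qed.

Lemma cell_close (R : realType) n B (g : R) (k : {ffun 'I_n * bool -> 'I_B})
    (v w : cmx R n 1) i : 0 < g -> cell g k v -> cell g k w ->
  cmod ((v : 'cV[Cplx R]_n) i 0 - (w : 'cV[Cplx R]_n) i 0) <= 2 * g.
Proof.
move=> g0 hv hw; apply: le_trans (cmod_le_ReIm _) _.
have H u : `|coordinate v u - coordinate w u| <= g.
  have := hv u; have := hw u; set x := coordinate v u; set y := coordinate w u.
  rewrite -natr1 => /andP[y1 y2] /andP[x1 x2].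
  have -> : x - y = ((x + 1) / g - (y + 1) / g) * g by field; rewrite gt_eqF.
  rewrite normrM (gtr0_norm g0) ler_piMl ?(ltW g0) // ler_norml; lra.
have := H (i, true); have := H (i, false); rewrite /coordinate /= -!raddfB; lra.
Qed.

Lemma measure_bigU_disjoint d (T : measurableType d) (R : realType)
    (P : probability T R) (I : eqType) (s : seq I) (F : I -> set T) :
  uniq s -> (forall i, measurable (F i)) ->
  (forall i j, i != j -> F i `&` F j = set0) ->
  P (\big[setU/set0]_(i <- s) F i) = (\sum_(i <- s) P (F i))%E.
Proof.
move=> us mF dF; elim: s us => [|a s IH]; first by rewrite !big_nil measure0.
rewrite cons_uniq => /andP[nas us]; rewrite !big_cons measureU //.
- by congr (_ + _)%E; exact: IH.
- by apply: bigsetU_measurable.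
- rewrite big_distrr /= big1_seq // => i /= si; apply: dF.
  by apply: contra nas => /eqP ->.
Qed.

(** On each cell the event [A] is disjoint from an event on [U] alone of probability at least [p].
    By independence [A] takes up at most the proportion [1 - p] of the cell, and the cells are
    summed. *)
Lemma small_eigenvalue_prob d (T : measurableType d) (R : realType)
    (P : probability T R) n (U : {RV P >-> cmx R n.+1 n.+1})
    (v : {RV P >-> cmx R n.+1 1}) (c p t eps : R) (W : 'M[Cplx R]_n.+1)
    (G : set (cmx R n.+1 n.+1)) (A : set T) :
  haar_unitary U -> (forall w, is_unit_vector (v w)) -> independent_RVs U v ->
  0 < t -> t < 1 -> 0 < c < 1 -> 0 < eps -> 2 * eps < Num.sqrt n%:R * t ->
  W \is unitarymx -> measurable G -> (p%:E <= P (U @^-1` G))%E ->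
  (forall M, M \is unitarymx -> G M -> forall z, cmod z <= c ->
     Num.sqrt n%:R * cmod (resolv (W *m M) z ord0 ord0 - 1) <= eps) ->
  measurable A ->
  (forall w, A w -> exists2 z, cmod z <= c &
     z \in eigenvalues (rank_one_perturbation (U w) (v w) t)) ->
  (P A <= (1 - p)%:E)%E.
Proof.
move=> hU v1 indep t0 t1 /andP[c0 c1] e0 et uW mG pG hG mA hA.
have c1' : 0 < 1 - c by rewrite subr_gt0.
pose s : R := Num.sqrt n%:R; have s0 : 0 <= s by apply: sqrtr_ge0.
pose N : R := n.+1%:R; have N0 : 0 < N by rewrite ltr0n.
(* This mesh makes the discretization error, multiplied by [sqrt n], at most [eps]. Together with
   the [eps] coming from [G] it stays below the threshold [sqrt n * t]. *)
pose g := eps * (1 - c) / (4 * N ^+ 2 * (s + 1)).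
have s1 : 0 < s + 1 by lra.
have N2 : 0 < 4 * N ^+ 2 * (s + 1) by rewrite mulr_gt0 // mulr_gt0 // exprn_gt0.
have g0 : 0 < g by rewrite divr_gt0 // mulr_gt0.
have gs : s * (N ^+ 2 * (2 * (2 * g) * (1 - c)^-1)) <= eps.
  have -> : s * (N ^+ 2 * (2 * (2 * g) * (1 - c)^-1)) = eps * (s / (s + 1)).
    by rewrite /g; field; rewrite !gt_eqF.
  by rewrite ler_piMr ?(ltW e0) // ler_pdivrMr // mul1r lerDl.
pose X k := v @^-1` (@cell R n.+1 (Num.truncn (2 / g)).+1 g k).
have mX k : measurable (X k).
  by rewrite -[X k]setTI; apply: measurable_funP => //; apply: measurable_cell.
pose pr (Y : set T) : R := fine (P Y).
have prE Y : measurable Y -> P Y = (pr Y)%:E.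
  by move=> mY; rewrite /pr fineK // fin_num_measure.
have key k : pr (A `&` X k) <= (1 - p) * pr (X k).
  have [Xk0|/set0P[w0 Xw0]] := eqVneq (X k) set0.
    by rewrite Xk0 setI0 /pr measure0 mulr0.
  have [V uV VE] := unit_vector_unitary (v1 w0).
  have uV' : V^t* \is unitarymx by rewrite trmxC_unitary.
  have uW' : W^t* \is unitarymx by rewrite trmxC_unitary.
  have uL : W^t* *m V^t* \is unitarymx by rewrite mul_unitarymx.
  pose Gk : set (cmx R n.+1 n.+1) := (fun M : cmx R n.+1 n.+1 =>
    (W^t* *m V^t*) *m (M : 'M[Cplx R]_n.+1) *m V : cmx R n.+1 n.+1) @^-1` G.
  have mGk : measurable Gk.
    by rewrite -[Gk]setTI; apply: (@cmx_mul_measurable R n.+1 (W^t* *m V^t*) V).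
  have PGk : P (U @^-1` Gk) = P (U @^-1` G) by apply: (hU.2 _ _ uL uV).
  have mUGk : measurable (U @^-1` Gk).
    by rewrite -[U @^-1` Gk]setTI; apply: measurable_funP.
  have disj : (A `&` X k) `&` (U @^-1` Gk `&` X k) = set0.
    apply/seteqP; split => // w [[Aw Xw] [Gw _]].
    have [z zc zE] := hA w Aw.
    have uw := hU.1 w.
    have close i : cmod ((v w : 'cV_n.+1) i 0 - (V *m (delta_mx 0 0 : 'cV_n.+1)) i 0) <= 2 * g.
      by rewrite VE; apply: cell_close g0 Xw Xw0.
    have h1 := perturbed_eigenvalue uw uV (v1 w) close t0 t1 c1 zc zE.
    have uM : W^t* *m V^t* *m U w *m V \is unitarymx by rewrite !mul_unitarymx.
    have h2 := hG _ uM Gw z zc.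
    have WE : W *m (W^t* *m V^t* *m U w *m V) = V^t* *m U w *m V.
      by rewrite !mulmxA (unitarymxP uW) mul1mx.
    rewrite WE in h2.
    have h3 := ler_wpM2l s0 h1; rewrite mulrDr in h3.
    by have := le_trans h3 (lerD h2 gs); move: et; clear; rewrite -/s; lra.
  have mAX : measurable (A `&` X k) by apply: measurableI.
  have mGX : measurable (U @^-1` Gk `&` X k) by apply: measurableI.
  have sumle : pr (A `&` X k) + pr (U @^-1` Gk `&` X k) <= pr (X k).
    rewrite -lee_fin EFinD -!prE // -measureU //.
    by apply: le_measure; rewrite ?inE //; [apply: measurableU|move=> w [[]|[]]].
  have prod : pr (U @^-1` Gk `&` X k) = pr (U @^-1` Gk) * pr (X k).
    apply: EFin_inj; rewrite EFinM -!prE //.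
    by apply: indep => //; apply: measurable_cell.
  have pk : p <= pr (U @^-1` Gk) by rewrite -lee_fin -prE // PGk.
  have X0 : 0 <= pr (X k) by rewrite fine_ge0.
  have := ler_wpM2r X0 pk; rewrite -prod; lra.
have cover : A `<=` \big[setU/set0]_k (A `&` X k).
  move=> w Aw; have [k hk] := cell_cover g0 (v1 w).
  by rewrite (bigD1 k) //=; left.
have mAX k : measurable (A `&` X k) by apply: measurableI.
have disjX k l : k != l -> X k `&` X l = set0.
  move=> kl; apply/seteqP; split => // w [h1 h2]; move/eqP: kl; apply.
  exact: cell_inj h1 h2.
have tot : \sum_k pr (X k) <= 1.
  rewrite -lee_fin -sumEFin (eq_bigr (fun k => P (X k))) => [|k _]; last by rewrite -prE.
  rewrite -(measure_bigU_disjoint P (index_enum_uniq _) mX disjX).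
  by apply: probability_le1; apply: bigsetU_measurable.
apply: (@le_trans _ _ (P (\big[setU/set0]_k (A `&` X k)))).
  by apply: le_measure; rewrite ?inE //; apply: bigsetU_measurable.
apply: le_trans (measure_bigU_le P _ _ mAX) _.
rewrite (eq_bigr (fun k => (pr (A `&` X k))%:E)) => [|k _]; last by rewrite -prE.
rewrite sumEFin lee_fin; apply: le_trans (ler_sum _ (fun k _ => key k)) _.
rewrite -mulr_sumr ler_piMr // subr_ge0 -lee_fin.
by apply: le_trans pG _; apply: probability_le1; rewrite -[_ @^-1` _]setTI; apply: measurable_funP.
Qed.

(** * From an eigenvalue in the small disk to a contradiction *)

Lemma separation_radius_le (R : realType) (c a : R) N :
  0 < c -> separation_radius c a N <= c.
Proof.
move=> c0; rewrite /separation_radius ler_piMr ?(ltW c0) //.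
have x0 : 0 <= N%:R `^ a by apply: powR_ge0.
by rewrite ler_pdivrMr ?mul1r ?lerDr // ltr_wpDr.
Qed.

Lemma num_eigenvalues_disk (R : realType) N (M : 'M[Cplx R]_N) (r : R) :
  (0 < num_eigenvalues_in (disk 0 r) M)%N ->
  exists2 z, cmod z <= r & z \in eigenvalues M.
Proof.
rewrite /num_eigenvalues_in -has_count => /hasP[z zE]; rewrite inE /disk /= subr0.
by rewrite normE toC_lt => /ltW zr; exists z.
Qed.

Theorem theorem15 (R : realType) (d : nat -> measure_display)
  (T : forall N : nat, measurableType (d N))
  (P : forall N : nat, probability (T N) R)
  (U : forall N : nat, {RV (P N) >-> cmx R N N})
  (v : forall N : nat, {RV (P N) >-> cmx R N 1})
  (U_haar : forall N : nat, (0 < N)%N -> haar_unitary (U N))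
  (v_unit : forall N : nat, (0 < N)%N -> forall w : T N, is_unit_vector (v N w))
  (Uv_indep : forall N : nat, (0 < N)%N -> independent_RVs (U N) (v N))
  (alpha : R) (alpha_gt0 : 0 < alpha) :
  ~ strongly_separated_outlier P
      (fun N (w : T N) (t : R) => rank_one_perturbation (U N w) (v N w) t)
      (fun N => [set alpha * N%:R `^ (- 2^-1)]).
Proof.
move=> [a1 [a2 [c [c2 [_ /andP[c0 c1] _ [A [hA cvA]]]]]]].
have c01 : 0 < c < 1 by rewrite c0.
(* Since [n + 1 <= 4 n], the threshold [sqrt n * t] is at least [alpha / 2] in dimension [n + 1],
   which exceeds twice [alpha / 8]. *)
have eps0 : 0 < alpha / 8 by rewrite divr_gt0.
have [p [n0 [p0 hn0]]] := swap_good c01 eps0.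
have bound : \forall N \near \oo, (P N (A N) <= (1 - p)%:E)%E.
  (* In dimension [n + 1] these bounds provide the estimate of [swap_good], the inequality [n >= 1],
     and [alpha^2 < n + 1], that is [t < 1]. *)
  exists (maxn n0 (maxn 1 (Num.truncn (alpha ^+ 2)))).+1 => // -[//|n].
  rewrite /= ltnS !geq_max => /andP[n0n /andP[n1 an]].
  have np : 0 < n%:R :> R by rewrite ltr0n.
  pose t : R := alpha * n.+1%:R `^ (- 2^-1).
  pose s : R := Num.sqrt n.+1%:R.
  have s0 : 0 < s by rewrite sqrtr_gt0 ltr0n.
  have tE : t = alpha / s by rewrite /t powRN powR12_sqrt.
  have t0 : 0 < t by rewrite tE divr_gt0.
  have t1 : t < 1.
    rewrite tE ltr_pdivrMr // mul1r -(ger0_norm (ltW alpha_gt0)) -sqrtr_sqr.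
    rewrite ltr_sqrt ?ltr0n //; have /andP[_] := truncn_itv (sqr_ge0 alpha).
    by move=> /lt_le_trans; apply; rewrite ler_nat ltnS.
  have et : 2 * (alpha / 8) < Num.sqrt n%:R * t.
    rewrite tE [ltRHS]mulrA ltr_pdivlMr //.
    have : s <= 2 * Num.sqrt n%:R.
      have -> : 2 * Num.sqrt n%:R = Num.sqrt (2 ^+ 2 * n%:R) :> R.
        by rewrite sqrtrM ?sqr_ge0 // sqrtr_sqr ger0_norm.
      apply: ler_wsqrtr; rewrite -natrX -natrM ler_nat.
      by rewrite -addn1 (leq_trans (leq_add (leqnn n) n1)) // addnn -mul2n leq_mul2r orbT.
    have : 0 < Num.sqrt n%:R :> R by rewrite sqrtr_gt0.
    nra.
  have [W [G [uW mG pG hG]]] := hn0 n n0n _ _ _ _ (U_haar n.+1 isT).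
  apply: (small_eigenvalue_prob (U_haar n.+1 isT) (v_unit n.+1 isT)
    (Uv_indep n.+1 isT) t0 t1 c01 eps0 et uW mG pG hG (hA n.+1).1).
  move=> w /(hA n.+1).2 /(_ t erefl)[h _].
  have [z zr zE] := num_eigenvalues_disk (eq_leq (esym h)); exists z => //.
  by apply: le_trans zr _; apply: separation_radius_le.
have cv : cvgn (fun N => P N (A N)) by apply/cvg_ex; exists 1%E.
(* The bound [1 - p] on the probabilities passes to their limit 1, although [p > 0]. *)
have : (1 <= (1 - p)%:E)%E by rewrite -(cvg_lim _ cvA) //; apply: lime_le.
by rewrite lee_fin leNgt gtrBl p0.
Qed.
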